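(* Given $S\subseteq N$, let $\Pi_S$ be the orthogonal projection matrix onto the space $U_S$. Let $(N,\nu)$ be the cost game in which $\nu(S)$ is the best upper bound on the output energy that can be certified by quadratic Lyapunov functions under the restricted controller $u_N:\mathbb{R}_+\to U_S$ (see the context). Then $(N,\nu)$ is equal to the linear-quadratic optimal control game $(N,\nu_{\rm LQ})$, where $$\nu_{\rm LQ}(S):=\min_{u_N(t)\in\mathbb{R}^R} J(u_N,x(0))$$ with the input data $(A_N,\ B_S:=B_N\Pi_S,\ C_N,\ D_S:=D_N\Pi_S)$, that is, for the system $\dot x_N=A_Nx_N+B_Su_N$ with output $z_N=C_Nx_N+D_Su_N$ and unrestricted control input. Moreover, $\nu(S)$ has the following conic representation in primal semidefinite programming standard form, writing $n=R+q$, $A=A_N$, $C=C_N$, $x_0=x(0)$: $$\nu(S)=\min_{Z\in\mathbb{S}^n}\ \langle C^\top C,Z_n\rangle+\langle D_S^\top D_S,Z_b\rangle$$ subject to $$Z_u^\top B_S^\top+B_SZ_u+Z_nA^\top+AZ_n=-x_0x_0^\top,\qquad Z:=\begin{bmatrix}Z_b&Z_u\\ Z_u^\top&Z_n\end{bmatrix}\succeq0,$$ where $Z_b\in\mathbb{S}^R$, $Z_u\in\mathbb{R}^{R\times q}$, $Z_n\in\mathbb{S}^q$.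
   Context: Setting. $N$ is a finite set of agents. Agent $i\in N$ has state $x_i(t)\in\mathbb{R}^{q_i}$, control input $u_i(t)\in\mathbb{R}^{r_i}$ and dynamics $\dot x_i(t)=\sum_{j\in N}[A_{ij}x_j(t)+B_{ij}u_j(t)]$, with $A_{ij}\in\mathbb{R}^{q_i\times q_j}$, $B_{ij}\in\mathbb{R}^{q_i\times r_j}$. The output of agent $i$ is $z_i(t)=C_ix_i(t)+D_iu_i(t)$, where $D_i^\top D_i$ is regular (invertible) and $D_i^\top C_i=0$. Put $q=\sum_i q_i$, $R=\sum_i r_i$, $A_N=(A_{ij})_{i,j\in N}$, $B_N=(B_{ij})_{i,j\in N}$, $C_N=\mathrm{diag}(C_i)_{i\in N}$, $D_N=\mathrm{diag}(D_i)_{i\in N}$ (block diagonal), so the overall system is $\dot x_N=A_Nx_N+B_Nu_N$, $z_N=C_Nx_N+D_Nu_N$, with given initial state $x(0)\in\mathbb{R}^q$. The output energy is $J(u_N,x(0))=\int_0^\infty z_N(t)^\top z_N(t)\,dt$. Coalitional restriction. For each $S\subseteq N$ a linear subspace $U_S\subseteq\mathbb{R}^R$ is given, with $U_S\subseteq U_T$ whenever $S\subseteq T$, and $U_N=\mathbb{R}^R$. Controllers are state feedbacks $u_N(t)=Kx_N(t)$, $K\in\mathbb{R}^{R\times q}$, and the restriction $u_N(t)\in U_S$ means $\mathrm{Im}(K)\subseteq U_S$. Standing assumption: for each $S$ there exist a gain $K$ with $\mathrm{Im}(K)\subseteq U_S$ that stabilizes the overall system, and a quadratic Lyapunov function $f(\xi)=\xi^\top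 P_S\xi$ for the closed-loop system that provides an upper bound on the output energy. Definition of $\nu$. $\nu(S)$ is the smallest (infimal) value of $x(0)^\top P x(0)$ over all pairs $(K,P)$ with $\mathrm{Im}(K)\subseteq U_S$, $P=P^\top\succ0$ and $$(A_N+B_NK)^\top P+P(A_N+B_NK)+(C_N+D_NK)^\top(C_N+D_NK)\preceq 0.$$ Conventions. $\mathbb{S}^k$ is the space of real symmetric $k\times k$ matrices, $\succeq$ is the Löwner order, $\langle X,Y\rangle=\mathrm{tr}(X^\top Y)$ for matrices, and ''min'' denotes the optimal value.
   Formalization: The minimum defining ν_LQ is taken only over inputs whose state tends to 0; without this the claim fails, e.g. for A=B=D=1, C=0, U_S=ℝ, where the unrestricted minimum of J is 0 but ν(S)=2x(0)². *)

(* Defs.v *)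
From HB Require Import structures.
From mathcomp Require Import all_boot all_order all_algebra.
From mathcomp Require Import all_classical all_reals all_analysis.

Set Implicit Arguments.
Unset Strict Implicit.
Unset Printing Implicit Defensive.

Import Order.TTheory GRing.Theory Num.Theory.
Import numFieldNormedType.Exports.

Local Open Scope classical_set_scope.
Local Open Scope ring_scope.

(* Blocks are laid out in the order of [enum N]: for k < #|N|, the k-th block
   belongs to the agent [agent k]. *)
Definition agent (N : finType) (k : 'I_#|N|) : N := enum_val k.

Definition dimN (N : finType) (d : N -> nat) : nat :=
  (\sum_(k < #|N|) d (agent k))%N.

Definition blockN (R : realType) (N : finType) (m n : N -> nat)
    (M : forall i j : N, 'M[R]_(m i, n j)) : 'M[R]_(dimN m, dimN n) :=
  \mxblock_(k < #|N|, l < #|N|) M (agent k) (agent l).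

(* [\mxdiag] only accepts square blocks. On the diagonal k = l the dimensions
   agree, so [conform_mx] returns M (agent k), only cast to the right type. *)
Definition diagN (R : realType) (N : finType) (m n : N -> nat)
    (M : forall i : N, 'M[R]_(m i, n i)) : 'M[R]_(dimN m, dimN n) :=
  \mxblock_(k < #|N|, l < #|N|)
    (if k == l then
       conform_mx (0 : 'M[R]_(m (agent k), n (agent l))) (M (agent k))
     else 0).

Definition quadform (R : realType) (n : nat) (P : 'M[R]_n) (v : 'cV[R]_n) : R :=
  (v^T *m P *m v) 0 0.

Definition posdef (R : realType) (n : nat) (P : 'M[R]_n) : Prop :=
  P^T = P /\ forall v : 'cV[R]_n, v != 0 -> 0 < quadform P v.

Definition possemidef (R : realType) (n : nat) (P : 'M[R]_n) : Prop :=
  P^T = P /\ forall v : 'cV[R]_n, 0 <= quadform P v.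

Definition loewner_le (R : realType) (n : nat) (P Q : 'M[R]_n) : Prop :=
  possemidef (Q - P).

Definition mxinner (R : realType) (m n : nat) (X Y : 'M[R]_(m, n)) : R :=
  \tr (X^T *m Y).

Definition is_orth_proj (R : realType) (n : nat)
    (U : {vspace 'cV[R]_n}) (Pi : 'M[R]_n) : Prop :=
  forall v : 'cV[R]_n, Pi *m v \in U /\
    forall w : 'cV[R]_n, w \in U -> w^T *m (v - Pi *m v) = 0.

Definition im_in (R : realType) (m n : nat)
    (K : 'M[R]_(m, n)) (U : {vspace 'cV[R]_m}) : Prop :=
  forall v : 'cV[R]_n, K *m v \in U.

Section LinearSystem.
Variables (R : realType) (q r p : nat).
Variables (A : 'M[R]_q) (B : 'M[R]_(q, r)) (C : 'M[R]_(p, q)) (D : 'M[R]_(p, r)).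

(* x solves x' = A x + B u on [0, +oo[ with x(0) = x0, in the sense of
   Caratheodory (integral form), for a locally integrable input u. Values at
   negative times are irrelevant. *)
Definition trajectory (x0 : 'cV[R]_q) (u : R -> 'cV[R]_r) (x : R -> 'cV[R]_q) :
    Prop :=
  [/\ forall (k : 'I_r) (t : R), 0 <= t ->
        (@lebesgue_measure R).-integrable `[0, t] (fun s => (u s k 0)%:E),
      forall k : 'I_q, {within `[0, +oo[, continuous (fun t => x t k 0)} &
      forall (k : 'I_q) (t : R), 0 <= t ->
        x t k 0 = x0 k 0 +
          Rintegral (@lebesgue_measure R) `[0, t]
            (fun s => (A *m x s + B *m u s) k 0)].

Definition vanishes (x : R -> 'cV[R]_q) : Prop :=
  forall k : 'I_q, x t k 0 @[t --> +oo] --> (0 : R).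

Definition stabilizing (K : 'M[R]_(r, q)) : Prop :=
  forall (xi : 'cV[R]_q) (x : R -> 'cV[R]_q),
    trajectory xi (fun t => K *m x t) x -> vanishes x.

Definition energy (u : R -> 'cV[R]_r) (x : R -> 'cV[R]_q) : \bar R :=
  (\int[@lebesgue_measure R]_(t in `[0%R, +oo[)
    (((C *m x t + D *m u t)^T *m (C *m x t + D *m u t)) 0 0)%:E)%E.

(* The optimal value is taken over the inputs that drive the state to 0.
   Without this usual admissibility condition, an unstable mode that is not
   visible in the output would be free of cost, whereas no positive definite
   Lyapunov certificate leaves it uncontrolled. *)
Definition lq_value (x0 : 'cV[R]_q) : \bar R :=
  ereal_inf [set J | exists (u : R -> 'cV[R]_r) (x : R -> 'cV[R]_q),
    [/\ trajectory x0 u x, vanishes x & J = energy u x]].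

Definition lyapunov_cert (K : 'M[R]_(r, q)) (P : 'M[R]_q) : Prop :=
  posdef P /\
  loewner_le ((A + B *m K)^T *m P + P *m (A + B *m K)
              + (C + D *m K)^T *m (C + D *m K)) 0.

Definition certified_value (U : {vspace 'cV[R]_r}) (x0 : 'cV[R]_q) : \bar R :=
  ereal_inf [set c | exists (K : 'M[R]_(r, q)) (P : 'M[R]_q),
    [/\ im_in K U, lyapunov_cert K P & c = (quadform P x0)%:E]].

Definition sdp_value (x0 : 'cV[R]_q) : \bar R :=
  ereal_inf [set c | exists (Zb : 'M[R]_r) (Zu : 'M[R]_(r, q)) (Zn : 'M[R]_q),
    [/\ possemidef (block_mx Zb Zu Zu^T Zn),
        Zu^T *m B^T + B *m Zu + Zn *m A^T + A *m Zn = - (x0 *m x0^T) &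
        c = (mxinner (C^T *m C) Zn + mxinner (D^T *m D) Zb)%:E]].

End LinearSystem.

(* Main.v *)
Require Import Defs.
From HB Require Import structures.
From mathcomp Require Import all_boot all_order all_algebra.
From mathcomp Require Import all_classical all_reals all_analysis.
From mathcomp Require Import measurable_realfun ring lra.

Set Implicit Arguments.
Unset Strict Implicit.
Unset Printing Implicit Defensive.

Import Order.TTheory GRing.Theory Num.Theory.
Import numFieldNormedType.Exports.

Local Open Scope ring_scope.

(** Fix a coalition, with projection [Pi] onto its space of inputs, and put
    [BS = B Pi] and [DS = D Pi]. The three values coincide because of the cycle
    of inequalities

      LQ <= nu <= SDP <= LQ.

    All three values are infima that need not be attained, so each inequality
    is obtained up to an arbitrarily small error. The stabilizing gain [K1]
    provided by the standing assumption is what makes the perturbations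
    possible.

    LQ <= nu ([lq_le_certified]). A certificate [(K, P)] bounds the energy of
    the output under the feedback [K], but it need not stabilize. In the
    variables [P^-1] and [K P^-1] the certificate inequality is convex, so [K]
    can be mixed with a small amount of a strict certificate with gain [K1]
    ([lyapunov_cert_mix]). The mixture is strict, hence stabilizing, and
    integrating minus the derivative of its Lyapunov function along the
    closed-loop trajectory bounds the energy ([feedback_energy_le]).

    nu <= SDP ([certified_le_sdp]). After adding a small multiple of a
    covariance of the feedback [K1], a feasible [Z] has a positive definite
    block [Zn] and a strictly negative right-hand side, so that [K = Zu Zn^-1]
    is stabilizing. The solution [P] of the Lyapunov equation of the closed loop
    is a certificate, and pairing that equation with [Zn], together with the
    Schur complement of [Zn] in [Z], bounds [x0^T P x0] by the cost of [Z]
    ([sdp_certificate]).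

    SDP <= LQ ([sdp_le_lq]). For a trajectory of finite energy, the integral
    over [[0, T]] of [v v^T] with [v = (Pi u, x)] satisfies the constraint of
    the program up to the endpoint term [x(T) x(T)^T], and its cost is the
    energy spent up to time [T] ([trajectory_covariance]). The endpoint term is
    absorbed by the covariance of the feedback [K1] started at [x(T)], whose
    cost tends to [0] with [x(T)].

    Two analytic tools carry this. The Lyapunov theory of a matrix [A] is
    derived from the flow [exp(t A) xi], defined by power series: a quadratic
    form that decreases along trajectories tending to [0] is nonnegative, which
    gives at once the solvability of Lyapunov equations and the sign of their
    solutions. And since inputs are merely integrable, the product rule for the
    components of a trajectory is obtained from Fubini's theorem on a triangle
    ([Rintegral_product_rule]). *)

(** * Quadratic forms and positive semidefinite matrices *)

Section QuadraticForms.
Variable R : realType.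

Lemma quadformD n (P Q : 'M[R]_n) v :
  quadform (P + Q) v = quadform P v + quadform Q v.
Proof. by rewrite /quadform mulmxDr mulmxDl mxE. Qed.

Lemma quadformN n (P : 'M[R]_n) v : quadform (- P) v = - quadform P v.
Proof. by rewrite /quadform mulmxN mulNmx mxE. Qed.

Lemma quadformB n (P Q : 'M[R]_n) v :
  quadform (P - Q) v = quadform P v - quadform Q v.
Proof. by rewrite quadformD quadformN. Qed.

Lemma quadformZ n a (P : 'M[R]_n) v : quadform (a *: P) v = a * quadform P v.
Proof. by rewrite /quadform -scalemxAr -scalemxAl mxE. Qed.

Lemma quadform_congr m n (P : 'M[R]_m) (G : 'M[R]_(m, n)) v :
  quadform (G^T *m P *m G) v = quadform P (G *m v).
Proof. by rewrite /quadform trmx_mul !mulmxA. Qed.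

Lemma quadform_gram m n (G : 'M[R]_(m, n)) v :
  quadform (G^T *m G) v = quadform 1%:M (G *m v).
Proof. by rewrite -quadform_congr mulmx1. Qed.

Lemma quadform1E n (v : 'cV[R]_n) : quadform 1%:M v = \sum_i v i 0 ^+ 2.
Proof.
by rewrite /quadform mulmx1 mxE; apply: eq_bigr => i _; rewrite mxE expr2.
Qed.

Lemma quadform1_ge0 n (v : 'cV[R]_n) : 0 <= quadform 1%:M v.
Proof. by rewrite quadform1E sumr_ge0// => i _; exact: sqr_ge0. Qed.

Lemma quadform1_eq0 n (v : 'cV[R]_n) : quadform 1%:M v = 0 -> v = 0.
Proof.
rewrite quadform1E => /eqP.
rewrite psumr_eq0; last by move=> i _; exact: sqr_ge0.
move=> /allP v0; apply/matrixP => i j; rewrite ord1 mxE.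
by have := v0 i (mem_index_enum _); rewrite /= sqrf_eq0 => /eqP.
Qed.

Lemma sqr_le_quadform1 n (v : 'cV[R]_n) i : v i 0 ^+ 2 <= quadform 1%:M v.
Proof.
rewrite quadform1E (bigD1 i)//= lerDl sumr_ge0// => j _; exact: sqr_ge0.
Qed.

Lemma quadformv0 n (P : 'M[R]_n) : quadform P 0 = 0.
Proof. by rewrite /quadform mulmx0 mxE. Qed.

Lemma outer_mxE m n (x : 'cV[R]_m) (y : 'cV[R]_n) i j :
  (x *m y^T) i j = x i 0 * y j 0.
Proof. by rewrite mxE big_ord1 [_^T _ _]mxE. Qed.

Lemma quadform_outer n (x v : 'cV[R]_n) :
  quadform (x *m x^T) v = ((x^T *m v) 0 0) ^+ 2.
Proof.
rewrite /quadform mulmxA -mulmxA mxE big_ord1 expr2; congr (_ * _).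
by rewrite !mxE; apply: eq_bigr => i _; rewrite !mxE mulrC.
Qed.

(** The symmetric bilinear form of [P]. *)
Definition bilform n (P : 'M[R]_n) (a b : 'cV[R]_n) : R := (a^T *m P *m b) 0 0.

Lemma bilformC n (P : 'M[R]_n) a b : P^T = P -> bilform P a b = bilform P b a.
Proof.
move=> Ps; rewrite /bilform -[in RHS]Ps.
by rewrite -[a in RHS]trmxK -trmx_mul -trmx_mul mulmxA [RHS]mxE.
Qed.

Lemma quadform_lin n (P : 'M[R]_n) (s t : R) a b : P^T = P ->
  quadform P (s *: a + t *: b) =
  s ^+ 2 * quadform P a + 2 * s * t * bilform P a b + t ^+ 2 * quadform P b.
Proof.
move=> Ps; have bC := bilformC a b Ps.
have -> : quadform P (s *: a + t *: b) =
    s * (s * bilform P a a + t * bilform P a b)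
    + t * (s * bilform P b a + t * bilform P b b).
  rewrite /quadform /bilform mulmxDr -!scalemxAr.
  have -> : (s *: a + t *: b)^T = s *: a^T + t *: b^T.
    by apply/matrixP => i j; rewrite !mxE.
  rewrite !mulmxDl -!scalemxAl !mxE.
  set aa := \sum_j _; set ab := \sum_j _; set ba := \sum_j _.
  by set bb := \sum_j _; ring.
rewrite -bC /quadform -/(bilform P a a) -/(bilform P b b); ring.
Qed.

(** The Cauchy-Schwarz inequality for a possibly degenerate form. *)
Lemma psd_cauchy_schwarz n (P : 'M[R]_n) a b : possemidef P ->
  bilform P a b ^+ 2 <= quadform P a * quadform P b.
Proof.
move=> [Ps Pp].
have g0 := Pp b; have a0 := Pp a.
(* This combination makes the form equal to ga * (al * ga - be ^ 2). *)
have := Pp (quadform P b *: a + (- bilform P a b) *: b).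
rewrite quadform_lin//.
set al := quadform P a; set be := bilform P a b; set ga := quadform P b in g0 *.
move=> h.
have [g_gt0|] := ltP 0 ga.
  have {}h : 0 <= ga * (al * ga - be ^+ 2) by nra.
  by rewrite -subr_ge0 -(pmulr_rge0 _ g_gt0).
(* If ga = 0, then be = 0: otherwise the form is negative at a + t b for the
   coefficient t below. *)
move=> g_le0; have gE : ga = 0 by apply/eqP; rewrite eq_le g_le0.
rewrite gE mulr0; have [->|be0] := eqVneq be 0; first by rewrite expr0n.
have := Pp (1 *: a + (- (al + 1) / (2 * be)) *: b).
rewrite quadform_lin// -/al -/be -/ga gE mulr0 addr0.
have -> : 1 ^+ 2 * al + 2 * 1 * (- (al + 1) / (2 * be)) * be = -1.
  by field.
by rewrite oppr_ge0 ler10.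
Qed.

Lemma psd1 n : possemidef (1%:M : 'M[R]_n).
Proof. by split; [rewrite tr_scalar_mx | exact: quadform1_ge0]. Qed.

Lemma posdef1 n : posdef (1%:M : 'M[R]_n).
Proof.
split; first by rewrite tr_scalar_mx.
move=> v v0; rewrite lt_def quadform1_ge0 andbT.
by apply: contra_neq v0; exact: quadform1_eq0.
Qed.

Lemma posdef_psd n (P : 'M[R]_n) : posdef P -> possemidef P.
Proof.
move=> [Ps Pp]; split=> // v; have [->|/Pp/ltW//] := eqVneq v 0.
by rewrite quadformv0.
Qed.

Lemma psdD n (P Q : 'M[R]_n) :
  possemidef P -> possemidef Q -> possemidef (P + Q).
Proof.
move=> [Ps Pp] [Qs Qp]; split; first by rewrite linearD /= Ps Qs.
by move=> v; rewrite quadformD addr_ge0.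
Qed.

Lemma psdZ n a (P : 'M[R]_n) : 0 <= a -> possemidef P -> possemidef (a *: P).
Proof.
move=> a0 [Ps Pp]; split; first by rewrite linearZ /= Ps.
by move=> v; rewrite quadformZ mulr_ge0.
Qed.

Lemma posdefDl n (P Q : 'M[R]_n) :
  possemidef P -> posdef Q -> posdef (P + Q).
Proof.
move=> [Ps Pp] [Qs Qp]; split; first by rewrite linearD /= Ps Qs.
by move=> v v0; rewrite quadformD ltr_wpDl// Qp.
Qed.

Lemma posdefZ n a (P : 'M[R]_n) : 0 < a -> posdef P -> posdef (a *: P).
Proof.
move=> a0 [Ps Pp]; split; first by rewrite linearZ /= Ps.
by move=> v v0; rewrite quadformZ mulr_gt0// Pp.
Qed.

Lemma psd_congr m n (P : 'M[R]_m) (G : 'M[R]_(m, n)) :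
  possemidef P -> possemidef (G^T *m P *m G).
Proof.
move=> [Ps Pp]; split; last by move=> v; rewrite quadform_congr.
by rewrite !trmx_mul trmxK Ps mulmxA.
Qed.

Lemma psd_gram m n (G : 'M[R]_(m, n)) : possemidef (G^T *m G).
Proof. by have := psd_congr G (psd1 m); rewrite mulmx1. Qed.

Lemma psd_outer n (x : 'cV[R]_n) : possemidef (x *m x^T).
Proof. by have := psd_gram x^T; rewrite trmxK. Qed.

Lemma quadform_delta n (P : 'M[R]_n) i : quadform P (delta_mx i 0) = P i i.
Proof. by rewrite /quadform trmx_delta -rowE -colE !mxE. Qed.

Lemma psd_tr_ge0 n (P : 'M[R]_n) : possemidef P -> 0 <= \tr P.
Proof. by move=> [_ Pp]; rewrite sumr_ge0// => i _; rewrite -quadform_delta. Qed.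

Lemma tr_mul_outer n (P : 'M[R]_n) (x : 'cV[R]_n) :
  \tr (P *m (x *m x^T)) = quadform P x.
Proof. by rewrite mulmxA mxtrace_mulC mulmxA /mxtrace big_ord1. Qed.

Lemma psd_tr_gram_ge0 m n (G : 'M[R]_(m, n)) (Y : 'M[R]_n) :
  possemidef Y -> 0 <= \tr (G^T *m G *m Y).
Proof.
move=> Yp; rewrite -mulmxA mxtrace_mulC; apply: psd_tr_ge0.
by have := psd_congr G^T Yp; rewrite trmxK.
Qed.

Lemma bilform_deltal n (P : 'M[R]_n) i (v : 'cV[R]_n) :
  bilform P (delta_mx i 0) v = (P *m v) i 0.
Proof. by rewrite /bilform trmx_delta -mulmxA -rowE mxE. Qed.

(** Cauchy-Schwarz for [P] with the basis vectors, applied to [P v]. *)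
Lemma psd_upper n (P : 'M[R]_n) v : possemidef P ->
  quadform P v <= \tr P * quadform 1%:M v.
Proof.
move=> Pp; have Pv := Pp.2 v.
have Pv2 : quadform 1%:M (P *m v) <= \tr P * quadform P v.
  rewrite quadform1E mulr_suml; apply: ler_sum => i _.
  by rewrite -bilform_deltal -quadform_delta psd_cauchy_schwarz.
have : quadform P v ^+ 2 <= quadform 1%:M v * quadform 1%:M (P *m v).
  rewrite (_ : quadform P v = bilform 1%:M v (P *m v)).
    by apply: psd_cauchy_schwarz; exact: psd1.
  by rewrite /bilform mulmx1 /quadform mulmxA.
have t0 := psd_tr_ge0 Pp; have v0 := quadform1_ge0 v.
have [->|qn0] := eqVneq (quadform P v) 0; first by rewrite mulr_ge0.
have q_gt0 : 0 < quadform P v by rewrite lt_def qn0.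
move=> h; rewrite -(ler_pM2r q_gt0) -expr2 (le_trans h)// mulrAC mulrC.
by rewrite ler_wpM2r.
Qed.

Lemma unitmx_inj n (P : 'M[R]_n) :
  (forall v : 'cV[R]_n, P *m v = 0 -> v = 0) -> P \in unitmx.
Proof.
move=> Pinj; rewrite -unitmx_tr -row_free_unit; apply: inj_row_free => w wP.
apply: trmx_inj; rewrite trmx0; apply: Pinj.
by rewrite -[P]trmxK -trmx_mul wP trmx0.
Qed.

Lemma posdef_unit n (P : 'M[R]_n) : posdef P -> P \in unitmx.
Proof.
move=> [_ Pp]; apply: unitmx_inj => v Pv0; apply/eqP; apply/negP => /negP/Pp.
by rewrite /quadform -mulmxA Pv0 mulmx0 mxE ltxx.
Qed.

Lemma posdef_inv n (P : 'M[R]_n) : posdef P -> posdef (invmx P).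
Proof.
move=> Pd; have Pu := posdef_unit Pd; have [Ps Pp] := Pd.
have Pis : (invmx P)^T = invmx P by rewrite trmx_inv Ps.
split=> // v v0.
have -> : invmx P = (invmx P)^T *m P *m invmx P by rewrite Pis mulVmx// mul1mx.
rewrite quadform_congr; apply: Pp; apply: contra_neq v0 => h.
by rewrite -[v](mulKVmx Pu) h mulmx0.
Qed.

(** Cauchy-Schwarz for [N] with the vectors [N^-1 e_i] gives the constant
    [1 / (tr (N^-1) + 1)]; adding [1] avoids a zero trace in dimension [0]. *)
Lemma posdef_lower n (N : 'M[R]_n) : posdef N ->
  exists2 c : R, 0 < c & forall v, c * quadform 1%:M v <= quadform N v.
Proof.
move=> Nd; have Nu := posdef_unit Nd; have Np := posdef_psd Nd.
have Nis : (invmx N)^T = invmx N by have [] := posdef_inv Nd.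
have t0 : 0 <= \tr (invmx N) by apply/psd_tr_ge0/posdef_psd/posdef_inv.
have t1 : 0 < \tr (invmx N) + 1 by rewrite ltr_wpDl.
exists (\tr (invmx N) + 1)^-1; first by rewrite invr_gt0.
move=> v; rewrite ler_pdivrMl// mulrDl mul1r ler_wpDr ?Np.2//.
rewrite quadform1E mulr_suml; apply: ler_sum => i _.
have -> : v i 0 = bilform N (invmx N *m delta_mx i 0) v.
  by rewrite /bilform trmx_mul Nis mulmxKV// trmx_delta -rowE mxE.
apply: le_trans (psd_cauchy_schwarz _ _ Np) _.
by rewrite -quadform_congr Nis mulVmx// mul1mx quadform_delta.
Qed.

Lemma symmx_eq0 n (X : 'M[R]_n) :
  X^T = X -> (forall v, quadform X v = 0) -> X = 0.
Proof.
move=> Xs X0; have Xp : possemidef X by split=> // v; rewrite X0.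
apply/matrixP => i j; rewrite mxE.
have := psd_cauchy_schwarz (delta_mx i 0) (delta_mx j 0) Xp.
rewrite !X0 mulr0 bilform_deltal -colE mxE => h.
by apply/eqP; rewrite -sqrf_eq0 eq_le h sqr_ge0.
Qed.

End QuadraticForms.

(** * The flow of a linear differential equation *)

Section Flow.
Variable R : realType.

(** The [n]-th Taylor coefficient at [0] of the [k]-th component of
    [exp(t A) xi]. *)
Definition flow_coef q (A : 'M[R]_q) (xi : 'cV[R]_q) (k : 'I_q) (n : nat) : R :=
  iter n (mulmx A) xi k 0 / n`!%:R.

(** The solution [exp(t A) xi] of [x' = A x], [x 0 = xi]. Its components are
    defined as sums of power series, so that neither powers of matrices nor a
    topology on matrices of possibly empty size are needed. *)
Definition flow q (A : 'M[R]_q) (xi : 'cV[R]_q) (t : R) : 'cV[R]_q :=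
  \col_k limn (pseries (flow_coef A xi k) t).

Lemma iter_mulmx_bound q (A : 'M[R]_q) (xi : 'cV[R]_q) n k :
  `|iter n (mulmx A) xi k 0| <=
  (\sum_i `|xi i 0|) * (\sum_i \sum_j `|A i j|) ^+ n.
Proof.
set a : R := \sum_i \sum_j _; set b : R := \sum_i `|xi i 0|.
have b0 : 0 <= b by rewrite sumr_ge0// => i _; exact: normr_ge0.
have a0 : 0 <= a.
  by rewrite sumr_ge0// => i _; rewrite sumr_ge0// => j _; exact: normr_ge0.
elim: n k => [|n IH] k /=.
  by rewrite expr0 mulr1 /b (bigD1 k)//= lerDl sumr_ge0.
rewrite mxE (le_trans (ler_norm_sum _ _ _))// exprS mulrCA.
apply: (@le_trans _ _ ((\sum_j `|A k j|) * (b * a ^+ n))).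
  rewrite mulr_suml; apply: ler_sum => j _.
  by rewrite normrM ler_wpM2l.
rewrite ler_wpM2r ?mulr_ge0 ?exprn_ge0// /a [leRHS](bigD1 k)//= lerDl.
rewrite sumr_ge0// => i _; rewrite sumr_ge0// => j _; exact: normr_ge0.
Qed.

Lemma is_cvg_flow q (A : 'M[R]_q) (xi : 'cV[R]_q) k t :
  cvgn (pseries (flow_coef A xi k) t).
Proof.
pose b : R := \sum_i `|xi i 0|; pose a : R := \sum_i \sum_j `|A i j|.
have b0 : 0 <= b by rewrite sumr_ge0// => i _; exact: normr_ge0.
have a0 : 0 <= a.
  by rewrite sumr_ge0// => i _; rewrite sumr_ge0// => j _; exact: normr_ge0.
apply: normed_cvg.
apply: (@series_le_cvg _ _ (fun n => b * exp_coeff (a * `|t|) n)) => /=.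
- by move=> n; exact: normr_ge0.
- by move=> n; rewrite mulr_ge0// exp_coeff_ge0// mulr_ge0.
- move=> n; rewrite /flow_coef /exp_coeff /= !normrM normrX normfV.
  rewrite (ger0_norm (ler0n _ _)) exprMn mulrAC.
  rewrite -(mulrA (a ^+ n)) -mulrA (mulrA b) mulrC (mulrC (b * _)).
  rewrite -mulrA (mulrA (`|t| ^+ n)) ler_wpM2l// ?mulr_ge0//.
  exact: iter_mulmx_bound.
- rewrite (_ : (fun n => _) = b *: exp_coeff (a * `|t|)); last by [].
  by apply: is_cvg_seriesZ; exact: is_cvg_series_exp_coeff.
Qed.

Lemma flow_coefS q (A : 'M[R]_q) (xi : 'cV[R]_q) k :
  pseries_diffs (flow_coef A xi k) = flow_coef A (A *m xi) k.
Proof.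
apply/funext => n; rewrite /pseries_diffs /flow_coef iterSr factS natrM invfM.
by rewrite mulrCA mulVKf.
Qed.

Lemma flow_mulmx q (A : 'M[R]_q) (xi : 'cV[R]_q) t :
  flow A (A *m xi) t = A *m flow A xi t.
Proof.
apply/matrixP => k l; rewrite ord1 !mxE; apply: cvg_lim => //.
have -> : pseries (flow_coef A (A *m xi) k) t =
    fun n => \sum_j A k j * pseries (flow_coef A xi j) t n.
  apply/funext => n; rewrite /pseries /series /=.
  under [RHS]eq_bigr do rewrite mulr_sumr.
  rewrite exchange_big /=; apply: eq_bigr => i _.
  rewrite /flow_coef -iterSr /= mxE !mulr_suml; apply: eq_bigr => j _.
  by rewrite !mulrA.
apply: cvg_big => [|j _]; first exact: add_continuous.
by rewrite mxE; apply: cvgMl_tmp; exact: is_cvg_flow.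
Qed.

Lemma flow0 q (A : 'M[R]_q) (xi : 'cV[R]_q) : flow A xi 0 = xi.
Proof.
apply/matrixP => k l; rewrite ord1 mxE; apply: lim_near_cst => //.
near=> n; have n0 : (0 < n)%N by near: n; exact: nbhs_infty_gt.
rewrite /pseries /series /= -(prednK n0) big_nat_recl//= big1_seq ?addr0.
  by rewrite /flow_coef /= expr0 mulr1 divr1.
by move=> i _; rewrite expr0n mulr0.
Unshelve. all: by end_near. Qed.

Lemma is_derive_flow q (A : 'M[R]_q) (xi : 'cV[R]_q) k t :
  is_derive t (1 : R) (fun s => flow A xi s k 0) ((A *m flow A xi t) k 0).
Proof.
rewrite -flow_mulmx mxE -flow_coefS.
have -> : (fun s => flow A xi s k 0) =
    (fun s => limn (pseries (flow_coef A xi k) s)).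
  by apply/funext => s; rewrite mxE.
apply: (@pseries_snd_diffs _ _ (`|t| + 1)).
- exact: is_cvg_flow.
- by rewrite flow_coefS; exact: is_cvg_flow.
- by rewrite !flow_coefS; exact: is_cvg_flow.
- by rewrite [ltRHS]ger0_norm ?addr_ge0// ltrDl.
Qed.

Lemma continuous_flow q (A : 'M[R]_q) (xi : 'cV[R]_q) k :
  continuous (fun s => flow A xi s k 0 : R).
Proof.
move=> t; apply/differentiable_continuous/derivable1_diffP.
by have [] := is_derive_flow A xi k t.
Qed.

(** A real matrix is Hurwitz when all solutions of [x' = A x] tend to [0]. *)
Definition hurwitz q (A : 'M[R]_q) : Prop :=
  forall xi, vanishes (flow A xi).

(** Along the flow of [A], the derivative of the quadratic form of [P] is the
    quadratic form of the Lyapunov operator [A^T P + P A]. *)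
Lemma is_derive_quadform_flow q (A P : 'M[R]_q) (xi : 'cV[R]_q) t :
  is_derive t (1 : R) (fun s => quadform P (flow A xi s))
    (quadform (A^T *m P + P *m A) (flow A xi t)).
Proof.
have -> : (fun s => quadform P (flow A xi s)) =
    \sum_i \sum_j (fun s : R => P i j * (flow A xi s i 0 * flow A xi s j 0)).
  apply/funext => s; rewrite /quadform -mulmxA mxE fct_sumE.
  apply: eq_bigr => i _; rewrite fct_sumE !mxE mulr_sumr; apply: eq_bigr => j _.
  by rewrite mulrCA.
have dij i j : is_derive t (1 : R)
    (fun s : R => P i j * (flow A xi s i 0 * flow A xi s j 0))
    (P i j * ((A *m flow A xi t) i 0 * flow A xi t j 0 +
              flow A xi t i 0 * (A *m flow A xi t) j 0)).
  have di := is_derive_flow A xi i t; have dj := is_derive_flow A xi j t.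
  apply: is_derive_eq (is_deriveZ (P i j) (is_deriveM di dj)) _.
  by rewrite /GRing.scale/=; ring.
have di i := is_derive_sum (dij i).
apply: is_derive_eq (is_derive_sum di) _.
set x := flow A xi t.
have -> : \sum_i \sum_j P i j * ((A *m x) i 0 * x j 0 + x i 0 * (A *m x) j 0) =
    bilform P (A *m x) x + bilform P x (A *m x).
  rewrite /bilform -!mulmxA !mxE -big_split /=; apply: eq_bigr => i _.
  rewrite !mxE !mulr_sumr -big_split /=; apply: eq_bigr => j _.
  by rewrite !mxE; ring.
by rewrite quadformD /quadform /bilform trmx_mul !mulmxA.
Qed.

End Flow.

(** * Lyapunov equations *)

Section Lyapunov.
Local Open Scope classical_set_scope.
Variable R : realType.

Lemma le0_is_derive_nincr (f df : R -> R) (a b : R) :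
  (forall t, is_derive t (1 : R) f (df t)) -> (forall t, df t <= 0) ->
  a <= b -> f b <= f a.
Proof.
move=> fd df0 ab.
have [|c _ fE] := MVT_segment ab (f := f) (df := df).

- apply: continuous_subspaceT => x.
  by apply/differentiable_continuous/derivable1_diffP; have [] := fd x.
- by rewrite -subr_le0 fE mulr_le0_ge0// subr_ge0.
Qed.

Lemma cvgr_sum (T I : Type) (F : set_system T) {FF : Filter F} (r : seq I)
    (f : I -> T -> R) (l : I -> R) :
  (forall i, f i x @[x --> F] --> l i) ->
  \sum_(i <- r) f i x @[x --> F] --> \sum_(i <- r) l i.
Proof.
by move=> fl; apply: cvg_big => [|i _]; [exact: add_continuous|exact: fl].
Qed.

Lemma vanishes_quadform q (P : 'M[R]_q) (x : R -> 'cV[R]_q) :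
  vanishes x -> quadform P (x t) @[t --> +oo] --> (0 : R).
Proof.
move=> x0.
have -> : (fun t => quadform P (x t)) =
    fun t => \sum_i \sum_j P i j * (x t i 0 * x t j 0).
  apply/funext => s; rewrite /quadform -mulmxA mxE.
  apply: eq_bigr => i _; rewrite !mxE mulr_sumr; apply: eq_bigr => j _.
  by rewrite mulrCA.
rewrite [X in _ --> X](_ : 0 = \sum_(i < q) \sum_(j < q) P i j * (0 * 0));
  last first.
  by rewrite big1// => i _; rewrite big1// => j _; rewrite !mulr0.
apply: cvgr_sum => i; apply: cvgr_sum => j.
by apply: cvgMl_tmp; apply: cvgM; exact: x0.
Qed.

(** If [P] does not increase along the flow of a Hurwitz matrix, then its value
    at any point is at least its limit [0]. *)
Lemma hurwitz_quadform_ge0 q (A P : 'M[R]_q) : hurwitz A ->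
  (forall v, quadform (A^T *m P + P *m A) v <= 0) ->
  forall v, 0 <= quadform P v.
Proof.
move=> hA dP v; have Pv := vanishes_quadform P (hA v).
apply: ler_cvg_to Pv (cvg_cst (quadform P v)) _.
near=> t; rewrite -[in leRHS](flow0 A v).
apply: (@le0_is_derive_nincr (fun s => quadform P (flow A v s))).
- by move=> s; exact: is_derive_quadform_flow.
- by move=> s; exact: dP.
- by near: t; exact: nbhs_pinfty_ge.
Unshelve. all: by end_near. Qed.

(** A solution of the homogeneous equation is constant along the flow, hence
    equal to its limit [0]. *)
Lemma hurwitz_lyapunov_inj q (A X : 'M[R]_q) : hurwitz A -> X^T = X ->
  A^T *m X + X *m A = 0 -> X = 0.
Proof.
move=> hA Xs X0; apply: symmx_eq0 => // v; apply/eqP; rewrite eq_le.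
rewrite -oppr_ge0 -quadformN !(hurwitz_quadform_ge0 hA)// => {}v.
  by rewrite X0 /quadform mulmx0 mul0mx mxE.
by rewrite mulmxN mulNmx -opprD X0 oppr0 /quadform mulmx0 mul0mx mxE.
Qed.

(** A linear endomorphism of the space of square matrices that is injective is
    surjective. *)
Lemma linear_inj_surj n (f : {linear 'M[R]_n -> 'M[R]_n}) :
  (forall X, f X = 0 -> X = 0) -> forall Y, exists X, f X = Y.
Proof.
move=> finj Y.
have fu : lin_mx f \in unitmx.
  rewrite -row_free_unit; apply: inj_row_free => w wf.
  have : f (vec_mx w) = 0.
    by apply: (can_inj mxvecK); rewrite -mul_vec_lin vec_mxK wf linear0.
  by move/finj => h; rewrite -[w]vec_mxK h linear0.
exists (vec_mx (mxvec Y *m invmx (lin_mx f))); apply: (can_inj mxvecK).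
by rewrite -mul_vec_lin vec_mxK mulmxKV.
Qed.

(** The linear map solved by the Lyapunov equation: on symmetric matrices it is
    [2 (A^T X + X A)], and its antisymmetric part detects the antisymmetric
    part of [X], which makes it injective on all matrices when the Lyapunov
    operator is injective on symmetric ones. *)
Definition lyapunov_op q (A X : 'M[R]_q) : 'M[R]_q :=
  A^T *m (X + X^T) + (X + X^T) *m A + (X - X^T).

Lemma lyapunov_op_is_linear q (A : 'M[R]_q) : linear (lyapunov_op A).
Proof.
move=> a X Y; rewrite /lyapunov_op.
have -> : (a *: X + Y)^T = a *: X^T + Y^T.
  by apply/matrixP => i j; rewrite !mxE.
rewrite !mulmxDl !mulmxDr -!scalemxAl -!scalemxAr !scalerDr opprD -!scalerN.
apply/matrixP => i j; rewrite !mxE.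
set s1 := \sum_k _; set s2 := \sum_k _; set s3 := \sum_k _; set s4 := \sum_k _.
by ring.
Qed.

HB.instance Definition _ q (A : 'M[R]_q) :=
  GRing.isLinear.Build R 'M[R]_q 'M[R]_q _ (lyapunov_op A)
    (lyapunov_op_is_linear A).

Lemma lyapunov_op_tr q (A X : 'M[R]_q) :
  (lyapunov_op A X)^T = A^T *m (X + X^T) + (X + X^T) *m A - (X - X^T).
Proof.
rewrite /lyapunov_op.
have trD (Y Z : 'M[R]_q) : (Y + Z)^T = Y^T + Z^T.
  by apply/matrixP => i j; rewrite !mxE.
have trN (Y : 'M[R]_q) : (- Y)^T = - Y^T.
  by apply/matrixP => i j; rewrite !mxE.
rewrite !trD trN trmxK !trmx_mul !trD !trmxK opprB (addrC X^T X).
by rewrite (addrC (_ *m A)) // (addrC X^T).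
Qed.

Lemma hurwitz_lyapunov_solve q (A M : 'M[R]_q) : hurwitz A -> M^T = M ->
  exists2 P, P^T = P & A^T *m P + P *m A = - M.
Proof.
move=> hA Ms.
have sym_tr (X : 'M[R]_q) : (X + X^T)^T = X + X^T.
  by apply/matrixP => i j; rewrite !mxE addrC.
have split0 (U V W : 'M[R]_q) : U + V = W -> U - V = W -> U = W /\ V = 0.
  move=> h1 h2; have V0 : V = 0.
    apply/matrixP => i j; have := h1; rewrite -h2 => /matrixP/(_ i j).
    by rewrite !mxE => h; lra.
  by rewrite -h1 V0 addr0.
have [X|X XM] := linear_inj_surj (f := lyapunov_op A) _ (- M).
  move=> X0; have := lyapunov_op_tr A X; rewrite X0 trmx0 => /esym h.
  have [/(hurwitz_lyapunov_inj hA (sym_tr X)) h1 h2] := split0 _ _ _ X0 h.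
  apply/matrixP => i j; move: h1 h2 => /matrixP/(_ i j) + /matrixP/(_ i j).
  by rewrite !mxE => h1 h2; lra.
have MT : (- M)^T = - M by apply/matrixP => i j; rewrite -[in RHS]Ms !mxE.
have := lyapunov_op_tr A X; rewrite [lyapunov_op A X]XM MT => /esym h.
have [h1 _] := split0 _ _ _ XM h.
by exists (X + X^T).
Qed.

(** The solution of the Lyapunov equation with positive semidefinite right-hand
    side is positive semidefinite, and likewise in the definite case. *)
Lemma hurwitz_lyapunov_psd q (A P M : 'M[R]_q) : hurwitz A -> possemidef M ->
  P^T = P -> A^T *m P + P *m A = - M -> possemidef P.
Proof.
move=> hA [_ Mp] Ps PM; split=> //; apply: (hurwitz_quadform_ge0 hA) => v.
by rewrite PM quadformN oppr_le0.
Qed.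

Lemma quadform_lyap q (A P : 'M[R]_q) v : P^T = P ->
  quadform (A^T *m P + P *m A) v = 2 * bilform P (A *m v) v.
Proof.
move=> Ps; have -> : quadform (A^T *m P + P *m A) v =
    bilform P (A *m v) v + bilform P v (A *m v).
  by rewrite quadformD /quadform /bilform trmx_mul !mulmxA.
by rewrite (bilformC v)// mulr2n mulrDl !mul1r.
Qed.

Lemma hurwitz_lyapunov_posdef q (A P M : 'M[R]_q) : hurwitz A -> posdef M ->
  P^T = P -> A^T *m P + P *m A = - M -> posdef P.
Proof.
move=> hA Md Ps PM.
have Pp := hurwitz_lyapunov_psd hA (posdef_psd Md) Ps PM.
split=> // v v0; rewrite lt_def Pp.2 andbT; apply/eqP => Pv0.
have b0 : bilform P (A *m v) v = 0.
  apply/eqP; rewrite -sqrf_eq0 eq_le sqr_ge0 andbT.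
  by apply: le_trans (psd_cauchy_schwarz _ _ Pp) _; rewrite Pv0 mulr0.
have := Md.2 v v0; rewrite -oppr_lt0 -quadformN -PM quadform_lyap// b0 mulr0.
by rewrite ltxx.
Qed.

(** Lyapunov's theorem: along the flow [quadform P] decays exponentially. *)
Lemma lyapunov_hurwitz q (A P N : 'M[R]_q) : posdef P -> posdef N ->
  (forall v, quadform (A^T *m P + P *m A) v <= - quadform N v) -> hurwitz A.
Proof.
move=> Pd Nd PN xi.
have [c c0 cN] := posdef_lower Nd; have [d d0 dP] := posdef_lower Pd.
have Pp := posdef_psd Pd; have t0 := psd_tr_ge0 Pp.
have t1 : 0 < \tr P + 1 by rewrite ltr_wpDl.
(* k is the decay rate: quadform N dominates k * quadform P. *)
pose k := c / (\tr P + 1); have k0 : 0 < k by rewrite divr_gt0.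
have kP v : k * quadform P v <= quadform N v.
  rewrite (le_trans _ (cN v))// /k -mulrA ler_pM2l// ler_pdivrMl//.
  rewrite mulrDl mul1r (le_trans (psd_upper v Pp))// lerDl.
  exact: quadform1_ge0.
pose V t := quadform P (flow A xi t).
have Vd t : 0 <= t -> V t <= V 0 * expR (- (k * t)).
  move=> t_ge0.
  have := @le0_is_derive_nincr (fun s => V s * expR (k * s))
    (fun s => expR (k * s) *
       (quadform (A^T *m P + P *m A) (flow A xi s) + k * V s)) 0 t.
  rewrite mulr0 expR0 mulr1 => h.
  rewrite expRN ler_pdivlMr ?expR_gt0//; apply: h => // s.
    have d1 := is_derive_quadform_flow A P xi s.
    have d2 : is_derive s (1 : R) (fun s => expR (k * s)) (k * expR (k * s)).
      by apply: is_derive_eq; rewrite /GRing.scale/= mulr1 mulrC.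
    by apply: is_derive_eq (is_deriveM d1 d2) _; rewrite /GRing.scale/= /V; ring.
  rewrite pmulr_rle0 ?expR_gt0//.
  by have := PN (flow A xi s); have := kP (flow A xi s); rewrite /V; lra.
move=> i.
have hx t : 0 <= t -> flow A xi t i 0 ^+ 2 <= d^-1 * V 0 * expR (- (k * t)).
  move=> /Vd h; apply: le_trans (sqr_le_quadform1 _ _) _.
  by rewrite -mulrA ler_pdivlMl// (le_trans _ h).
apply/cvgr0Pnorm_lt => e e0.
have e20 : 0 < e ^+ 2 by rewrite exprn_gt0.
have : d^-1 * V 0 * expR (- (k * t)) @[t --> +oo] --> d^-1 * V 0 * 0.
  apply: cvgMl_tmp; apply: (cvg_comp _ _ _ (@cvgr_expR R)).
  apply: gt0_cvgMry => //.
rewrite mulr0 => /cvgr0Pnorm_lt/(_ _ e20) h.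
near=> t; rewrite -(@ltr_pXn2r _ 2)// ?nnegrE// ?(ltW e0)//.
rewrite -normrX ger0_norm ?sqr_ge0//; apply: le_lt_trans (hx t _) _.
  by near: t; exact: nbhs_pinfty_ge.
by apply: le_lt_trans (ler_norm _) _; near: t.
Unshelve. all: by end_near. Qed.

(** If [A^T W + W A = -1] with [W] positive definite, then [W^-1] is a strict
    Lyapunov function for [A^T]. *)
Lemma hurwitz_tr q (A : 'M[R]_q) : hurwitz A -> hurwitz A^T.
Proof.
move=> hA; have [W Ws WM] := hurwitz_lyapunov_solve hA (tr_scalar_mx q 1).
have Wd := hurwitz_lyapunov_posdef hA (posdef1 R q) Ws WM.
have Wu := posdef_unit Wd; have Vd := posdef_inv Wd.
have Vs := Vd.1.
apply: (lyapunov_hurwitz Vd (N := invmx W *m invmx W)).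
  have := posdef_inv Wd.
  split; first by rewrite trmx_mul Vs.
  move=> v v0; rewrite -{1}Vs quadform_gram; apply: (posdef1 R q).2.
  by apply: contra_neq v0 => h; rewrite -[v](mulKVmx Wu) h mulmx0.
move=> v; rewrite trmxK -quadformN.
suff -> : A *m invmx W + invmx W *m A^T = - (invmx W *m invmx W) by [].
have := congr1 (fun X => invmx W *m X *m invmx W) WM.
rewrite mulmxDr mulmxDl !mulmxA mulVmx// mul1mx -!mulmxA mulmxV// mulmx1.
by rewrite addrC mulNmx mulmxN mul1mx.
Qed.

End Lyapunov.

(** * Linear state feedback *)

Section Feedback.
Variable R : realType.
Local Open Scope classical_set_scope.

Lemma continuous_mulmx_flow m q (G : 'M[R]_(m, q)) (A : 'M[R]_q)
    (xi : 'cV[R]_q) k : continuous (fun s => (G *m flow A xi s) k 0 : R).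
Proof.
move=> t; rewrite /continuous_at mxE.
have -> : (fun s => (G *m flow A xi s) k 0) =
    fun s => \sum_j G k j * flow A xi s j 0.
  by apply/funext => s; rewrite mxE.
by apply: cvgr_sum => j; apply: cvgMl_tmp; exact: continuous_flow.
Qed.

Lemma continuous_quadform_flow q (A P : 'M[R]_q) (xi : 'cV[R]_q) :
  continuous (fun s => quadform P (flow A xi s) : R).
Proof.
move=> t; apply/differentiable_continuous/derivable1_diffP.
by have [] := is_derive_quadform_flow A P xi t.
Qed.

Lemma feedback_trajectory q r (A : 'M[R]_q) (B : 'M[R]_(q, r))
    (K : 'M[R]_(r, q)) (xi : 'cV[R]_q) :
  trajectory A B xi (fun t => K *m flow (A + B *m K) xi t)
    (flow (A + B *m K) xi).
Proof.
split.
- move=> k t t0; apply: continuous_compact_integrable => /=.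
    exact: segment_compact.
  by apply: continuous_subspaceT; exact: continuous_mulmx_flow.
- by move=> k; apply: continuous_subspaceT; exact: continuous_flow.
- move=> k t; rewrite le_eqVlt => /predU1P[<-|t0].
    by rewrite set_itv1 Rintegral_set1 addr0 flow0.
  have dx s := is_derive_flow (A + B *m K) xi k s.
  have FTC : (\int[@lebesgue_measure R]_(s in `[0%R, t])
      ((A *m flow (A + B *m K) xi s +
        B *m (K *m flow (A + B *m K) xi s)) k 0)%:E =
      (flow (A + B *m K) xi t k 0)%:E - (flow (A + B *m K) xi 0 k 0)%:E)%E.
    have -> : (fun s => ((A *m flow (A + B *m K) xi s +
          B *m (K *m flow (A + B *m K) xi s)) k 0)%:E) =
        (fun s => ((((A + B *m K) *m flow (A + B *m K) xi s)) k 0)%:E).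
      by apply/funext => s; rewrite mulmxA -mulmxDl.
    apply: (@continuous_FTC2 _ _ (fun s => flow (A + B *m K) xi s k 0)) => //.
    - by apply: continuous_subspaceT; exact: continuous_mulmx_flow.
    - split.
      + by move=> s _; have [] := dx s.
      + by apply/cvg_at_right_filter; exact: continuous_flow.
      + by apply/cvg_at_left_filter; exact: continuous_flow.
    - by move=> s _; rewrite derive1E; exact: derive_val.
  by rewrite /Rintegral FTC /= flow0 subrKC.
Qed.

Lemma stabilizing_hurwitz q r (A : 'M[R]_q) (B : 'M[R]_(q, r))
    (K : 'M[R]_(r, q)) : stabilizing A B K -> hurwitz (A + B *m K).
Proof. by move=> stK xi; exact: stK (feedback_trajectory A B K xi). Qed.

(** A quadratic Lyapunov certificate of a stabilizing feedback bounds the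
    energy of its output. *)
Lemma feedback_energy_le q r p (A : 'M[R]_q) (B : 'M[R]_(q, r))
    (C : 'M[R]_(p, q)) (D : 'M[R]_(p, r)) (K : 'M[R]_(r, q)) (P : 'M[R]_q)
    (xi : 'cV[R]_q) :
  hurwitz (A + B *m K) ->
  (forall v, quadform ((A + B *m K)^T *m P + P *m (A + B *m K)) v <=
     - quadform ((C + D *m K)^T *m (C + D *m K)) v) ->
  (energy C D (fun t => K *m flow (A + B *m K) xi t) (flow (A + B *m K) xi)
    <= (quadform P xi)%:E)%E.
Proof.
set Acl := A + B *m K; set M := (_ + _)^T *m (_ + _) => hA PM.
pose f t := - quadform (Acl^T *m P + P *m Acl) (flow Acl xi t).
have fM t : quadform M (flow Acl xi t) <= f t.
  by rewrite /f lerNr; exact: PM.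
have M0 t : 0 <= quadform M (flow Acl xi t) by exact: (psd_gram _).2.
have f0 t : 0 <= f t by exact: le_trans (fM t).
have fc : continuous f.
  by move=> t; apply: cvgN; exact: continuous_quadform_flow.
have Mc : continuous (fun t => quadform M (flow Acl xi t)).
  exact: continuous_quadform_flow.
have dF t : is_derive t (1 : R) (fun t => - quadform P (flow Acl xi t)) (f t).
  exact: is_deriveN (is_derive_quadform_flow Acl P xi t).
have intf :
    (\int[@lebesgue_measure R]_(t in `[0%R, +oo[) (f t)%:E = (quadform P xi)%:E)%E.
  rewrite (@ge0_continuous_FTC2y _ f (fun t => - quadform P (flow Acl xi t)) 0 0).
  - by rewrite flow0 EFinN oppeK add0e.
  - by [].
  - by apply: continuous_subspaceT.
  - by rewrite -[X in _ --> X]oppr0; apply: cvgN; exact: vanishes_quadform (hA xi).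
  - by move=> t _; have [] := dF t.
  - apply/cvg_at_right_filter; apply: cvgN; exact: continuous_quadform_flow.
  - by move=> t _; rewrite derive1E; exact: derive_val.
rewrite -intf.
rewrite /energy.
have -> : (fun t => (((C *m flow Acl xi t + D *m (K *m flow Acl xi t))^T *m
     (C *m flow Acl xi t + D *m (K *m flow Acl xi t))) 0 0)%:E) =
   (fun t => (quadform M (flow Acl xi t))%:E).
  apply/funext => t; rewrite quadform_gram /quadform mulmx1.
  by rewrite mulmxDl mulmxA.
apply: ge0_le_integral => //=.
- by move=> t _; rewrite lee_fin.
- apply/measurable_EFinP; apply/measurable_funTS.
  exact: continuous_measurable_fun.
- apply/measurable_EFinP; apply/measurable_funTS.
  exact: continuous_measurable_fun.
- by move=> t _; rewrite lee_fin.
Qed.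

End Feedback.

(** * The product rule for indefinite Lebesgue integrals *)

Section ProductRule.
Variable R : realType.
Local Open Scope classical_set_scope.
Local Notation mu := (@lebesgue_measure R).

Lemma integrable_EFin_restrict (f : R -> R) (D : set R) : measurable D ->
  mu.-integrable D (EFin \o f) -> mu.-integrable setT (EFin \o (f \_ D)).
Proof.
move=> mD fi; have := (iffLR (@integrable_mkcond _ _ _ mu D _ mD)) fi.
by rewrite restrict_EFin.
Qed.

Lemma integral_restrictZ (f : R -> R) (D : set R) (c : R) : measurable D ->
  mu.-integrable D (EFin \o f) ->
  (\int[mu]_t (c * (f \_ D) t)%:E = (c * \int[mu]_(t in D) f t)%R%:E)%E.
Proof.
move=> mD /(integrable_EFin_restrict mD) fi.
under eq_integral do rewrite EFinM.
rewrite integralZl// EFinM Rintegral_mkcond /Rintegral fineK//.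
exact: integrable_fin_num.
Qed.

(** Fubini's theorem on the triangle [0 <= s <= t <= T]. *)
Lemma Rintegral_triangle (f g : R -> R) (T : R) :
  mu.-integrable `[0, T] (EFin \o f) -> mu.-integrable `[0, T] (EFin \o g) ->
  \int[mu]_(t in `[0, T]) (f t * \int[mu]_(s in `[0, t]) g s) =
  \int[mu]_(s in `[0, T]) (g s * \int[mu]_(t in `[s, T]) f t).
Proof.
move=> fi gi; set D := `[0, T]%classic.
have mD : measurable D by exact: measurable_itv.
pose fD := f \_ D; pose gD := g \_ D.
have fDi : mu.-integrable setT (EFin \o fD).
  exact: integrable_EFin_restrict.
have gDi : mu.-integrable setT (EFin \o gD).
  exact: integrable_EFin_restrict.
have mfD : measurable_fun setT fD by apply/measurable_EFinP; case/integrableP : fDi.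
have mgD : measurable_fun setT gD by apply/measurable_EFinP; case/integrableP : gDi.
(* The integrand on the plane: f t * g s on the triangle, 0 elsewhere. *)
pose h (z : R * R) : R := fD z.1 * gD z.2 * \1_[set z : R * R | z.2 <= z.1] z.
have h1 t s : h (t, s) = fD t * (g \_ `[0, t]) s.
  rewrite /h /fD /gD /= -mulrA patchE [in RHS]patchE.
  have [tD|] := boolP (t \in D); last by rewrite !mul0r.
  have /andP[t0 tT] : 0 <= t <= T by move: tD; rewrite inE /D /= in_itv.
  congr (_ * _); rewrite indicE patchE /D.
  case: (boolP (s \in `[0%R, t]%classic)) => [|sD].
    rewrite inE /= in_itv /= => /andP[s0 st].
    by rewrite !mem_set/= ?mulr1// in_itv/= s0 (le_trans st).
  case: ifPn => [|_]; last by rewrite mul0r.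
  rewrite inE /= in_itv /= => /andP[s0 sT].
  rewrite memNset ?mulr0//= => st; move/negP: sD; apply.
  by rewrite inE /= in_itv /= s0 st.
have h2 t s : h (t, s) = gD s * (f \_ `[s, T]) t.
  rewrite /h /fD /gD /= mulrAC mulrC patchE [in RHS]patchE.
  have [sD|] := boolP (s \in D); last by rewrite !mul0r.
  have /andP[s0 sT] : 0 <= s <= T by move: sD; rewrite inE /D /= in_itv.
  congr (_ * _); rewrite indicE patchE /D.
  case: (boolP (t \in `[s, T]%classic)) => [|tD].
    rewrite inE /= in_itv /= => /andP[st tT].
    by rewrite !mem_set/= ?mulr1// in_itv/= tT (le_trans s0).
  case: ifPn => [|_]; last by rewrite mul0r.
  rewrite inE /= in_itv /= => /andP[t0 tT].
  rewrite memNset ?mulr0//= => st; move/negP: tD; apply.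
  by rewrite inE /= in_itv /= st tT.
have mh : measurable_fun setT (EFin \o h).
  apply/measurable_EFinP; apply: measurable_funM.
    by apply: measurable_funM; apply: measurableT_comp.
  apply: measurable_indic.
  rewrite (_ : [set z | _] = (fun z : R * R => z.1 - z.2) @^-1` `[0, +oo[).
    rewrite -[X in measurable X]setTI.
    by apply: measurable_funB; [exact: measurable_fst|exact: measurable_snd| |].
  by apply/seteqP; split => z /=; rewrite in_itv/= andbT subr_ge0.
have ih : (mu \x mu)%E.-integrable setT (EFin \o h).
  apply/(integrable12ltyP mu mu mh) => /=.
  pose c := (\int[mu]_s `|(gD s)%:E|)%E.
  have cE : c = (fine c)%:E.
    rewrite fineK// ge0_fin_numE ?integral_ge0//.
    by case/integrableP : gDi.
  apply: (@le_lt_trans _ _ (\int[mu]_t ((fine c)%:E * `|(fD t)%:E|))%E).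
    apply: ge0_le_integral => //.
    - by move=> t _; exact: integral_ge0.
    - have mah := measurableT_comp (@abse_measurable R setT) mh.
      have := @measurable_fun_fubini_tonelli_F _ _ _ _ R mu _ mah.
      by apply => z /=; rewrite lee_fin.
    - apply: emeasurable_funM => //; apply: measurableT_comp => //.
      exact/measurable_EFinP.
    - move=> t _; rewrite -cE muleC /c -ge0_integralZl//; last first.
        by apply: measurableT_comp => //; exact/measurable_EFinP.
      apply: ge0_le_integral => //.
      + have mht := measurableT_comp mh (pair1_measurable t).
        exact: (measurableT_comp (@abse_measurable R setT) mht).
      + apply: emeasurable_funM => //; apply: measurableT_comp => //.
        exact/measurable_EFinP.
      + move=> s _; rewrite -abseM lee_fin /h !normrM ler_piMr ?mulr_ge0//.
        by rewrite indicE; case: (_ \in _); rewrite ?normr1 ?normr0.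
  have c0 : (0 <= (fine c)%:E)%E by rewrite -cE integral_ge0.
  have mfDa : measurable_fun setT (fun t => `|(fD t)%:E|%E).
    by apply: measurableT_comp => //; exact/measurable_EFinP.
  rewrite ge0_integralZl// lte_mul_pinfty//.
  by case/integrableP : fDi.
have FUB := Fubini ih.
have e1 t : (\int[mu]_s (h (t, s))%:E)%E =
    ((fun t => f t * \int[mu]_(s in `[0, t]) g s) \_ D t)%:E.
  under eq_integral do rewrite h1.
  rewrite /fD !patchE; have [tD|] := boolP (t \in D); last first.
    by under eq_integral do rewrite mul0r; rewrite integral0.
  have gt : mu.-integrable `[0, t] (EFin \o g).
    apply: (integrableS _ _ _ gi); [exact: measurable_itv..|].
    move: tD; rewrite inE /D /= in_itv /= => /andP[_ tT].
    by apply: subset_itvl; rewrite bnd_simp.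
  exact: (integral_restrictZ _ (measurable_itv _)).
have e2 s : (\int[mu]_t (h (t, s))%:E)%E =
    ((fun s => g s * \int[mu]_(t in `[s, T]) f t) \_ D s)%:E.
  under eq_integral do rewrite h2.
  rewrite /gD !patchE; have [sD|] := boolP (s \in D); last first.
    by under eq_integral do rewrite mul0r; rewrite integral0.
  have ft : mu.-integrable `[s, T] (EFin \o f).
    apply: (integrableS _ _ _ fi); [exact: measurable_itv..|].
    move: sD; rewrite inE /D /= in_itv /= => /andP[s0 _].
    by apply: subset_itvr; rewrite bnd_simp.
  exact: (integral_restrictZ _ (measurable_itv _)).
rewrite Rintegral_mkcond [RHS]Rintegral_mkcond /Rintegral.
under eq_integral do rewrite -e1.
under [in RHS]eq_integral do rewrite -e2.
by rewrite FUB.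
Qed.

Lemma integrableM_continuous (f G : R -> R) (T : R) :
  mu.-integrable `[0, T] (EFin \o f) -> {within `[0, T], continuous G} ->
  mu.-integrable `[0, T] (EFin \o (fun t => f t * G t)).
Proof.
move=> fi Gc.
have -> : EFin \o (fun t => f t * G t) =
      ((EFin \o f) \* (EFin \o G))%E.
  by apply/funext => t /=; rewrite EFinM.
apply: integrableMl => //.
  exact: subspace_continuous_measurable_fun.
have /compact_bounded[M [_ Mb]] :=
  continuous_compact Gc (@segment_compact R 0 T).
by exists M; split; rewrite ?num_real // => ? ? ? ?; exact: Mb.
Qed.

(** The product rule for two functions [F] and [G] that are the indefinite
    integrals of integrable functions [f] and [g], which need not be
    continuous. *)
Lemma Rintegral_product_rule (f g F G : R -> R) (T : R) : 0 <= T ->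
  mu.-integrable `[0, T] (EFin \o f) -> mu.-integrable `[0, T] (EFin \o g) ->
  {within `[0, T], continuous F} -> {within `[0, T], continuous G} ->
  (forall t, 0 <= t <= T -> F t = F 0 + \int[mu]_(s in `[0, t]) f s) ->
  (forall t, 0 <= t <= T -> G t = G 0 + \int[mu]_(s in `[0, t]) g s) ->
  \int[mu]_(t in `[0, T]) (f t * G t + g t * F t) = F T * G T - F 0 * G 0.
Proof.
move=> T0 fi gi Fc Gc FE GE; have mD : measurable `[0, T] by exact: measurable_itv.
have TT : 0 <= T <= T by rewrite T0 lexx.
have fGi := integrableM_continuous fi Gc; have gFi := integrableM_continuous gi Fc.
rewrite RintegralD//.
have [cfi cgi] : mu.-integrable `[0, T] (EFin \o (fun t => f t * G 0)) /\
   mu.-integrable `[0, T] (EFin \o (fun t => g t * F T)).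
  by split; apply: integrableM_continuous => //; apply: continuous_subspaceT => x;
     exact: cvg_cst.
have := Rintegral_triangle fi gi.
have -> : \int[mu]_(t in `[0, T]) (f t * \int[mu]_(s in `[0, t]) g s) =
    \int[mu]_(t in `[0, T]) (f t * G t) - G 0 * \int[mu]_(t in `[0, T]) f t.
  rewrite [G 0 * _]mulrC -RintegralZr// -RintegralB//; apply: eq_Rintegral => t.
  by rewrite inE /= in_itv /= => /GE ->; ring.
have -> : \int[mu]_(s in `[0, T]) (g s * \int[mu]_(t in `[s, T]) f t) =
    F T * \int[mu]_(t in `[0, T]) g t - \int[mu]_(t in `[0, T]) (g t * F t).
  rewrite [F T * _]mulrC -RintegralZr// -RintegralB//; apply: eq_Rintegral => t.
  rewrite inE /= in_itv /= => tT; have /andP[t0 tleT] := tT.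
  rewrite (FE _ tT) (FE _ TT) -Rintegral_itv_obnd_cbnd; last first.
    by apply: integrableS fi => //; apply: subset_itv; rewrite bnd_simp.
  rewrite -(@Rintegral_itvB _ _ (BLeft 0)) ?bnd_simp//; ring.
move=> h; have := FE _ TT; have := GE _ TT => hG hF.
set a := \int[mu]_(t in `[0, T]) (f t * G t) in h *.
set b := \int[mu]_(t in `[0, T]) (g t * F t) in h *.
set c := \int[mu]_(t in `[0, T]) f t in h hF.
set d := \int[mu]_(t in `[0, T]) g t in h hG.
by have -> : a + b = G 0 * c + F T * d by [lra]; rewrite hF hG; ring.
Qed.

End ProductRule.

(** * Convex combination of certificates *)

Section ConvexCombination.
Variable R : realType.

Lemma quadform_conv n (P Q : 'M[R]_n) a b v :
  quadform (a *: P + b *: Q) v = a * quadform P v + b * quadform Q v.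
Proof. by rewrite quadformD !quadformZ. Qed.

Lemma bilform_linl n (P : 'M[R]_n) a b x z y :
  bilform P (a *: x + b *: z) y = a * bilform P x y + b * bilform P z y.
Proof.
rewrite /bilform.
have -> : (a *: x + b *: z)^T = a *: x^T + b *: z^T.
  by apply/matrixP => i j; rewrite !mxE.
by rewrite !mulmxDl -!scalemxAl mxE !mxE.
Qed.

(** The Fenchel-Young inequality between a quadratic form and its conjugate. *)
Lemma posdef_fenchel_young n (P : 'M[R]_n) x y : posdef P ->
  2 * bilform 1%:M x y <= quadform P x + quadform (invmx P) y.
Proof.
move=> Pd; have Pu := posdef_unit Pd; have Id := posdef_inv Pd.
have := (posdef_psd Id).2 (1 *: y + (-1) *: (P *m x)).
rewrite quadform_lin ?Id.1//.
have -> : quadform (invmx P) (P *m x) = quadform P x.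
  by rewrite -quadform_congr Pd.1 mulmxV// mul1mx.
have -> : bilform (invmx P) y (P *m x) = bilform 1%:M x y.
  rewrite (bilformC x)//; last exact: tr_scalar_mx.
  by rewrite /bilform -!mulmxA mulKmx// mul1mx.
lra.
Qed.

Lemma posdef_fenchel_eq n (P : 'M[R]_n) x : posdef P ->
  2 * bilform 1%:M x (P *m x) = quadform P x + quadform (invmx P) (P *m x).
Proof.
move=> Pd; have Pu := posdef_unit Pd.
rewrite -quadform_congr Pd.1 mulmxV// mul1mx.
by rewrite /bilform mulmx1 mulmxA /quadform mulr2n mulrDl !mul1r.
Qed.

Lemma quadform1_convex n (a b : 'cV[R]_n) (e : R) : 0 <= e <= 1 ->
  quadform 1%:M ((1 - e) *: a + e *: b) <=
  (1 - e) * quadform 1%:M a + e * quadform 1%:M b.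
Proof.
move=> /andP[e0 e1].
have := quadform1_ge0 (1 *: a + (-1) *: b).
rewrite !quadform_lin ?tr_scalar_mx//.
set x := quadform _ a; set y := quadform _ b; set z := bilform _ a b => h.
have : 0 <= e * (1 - e) * (x - 2 * z + y).
  by rewrite mulr_ge0 ?mulr_ge0 ?subr_ge0//; lra.
nra.
Qed.

Variables (q r p : nat) (A : 'M[R]_q) (B : 'M[R]_(q, r)).
Variables (C : 'M[R]_(p, q)) (D : 'M[R]_(p, r)).

(** In the variables [Q = P^-1] and [Y = K Q] the certificate inequality is
    convex; mixing in a strict certificate [(K1, P1)] gives a strict one, hence
    a stabilizing gain. *)
Lemma lyapunov_cert_mix (K K1 : 'M[R]_(r, q)) (P P1 : 'M[R]_q) (e : R) :
  lyapunov_cert A B C D K P -> posdef P1 ->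
  (A + B *m K1)^T *m P1 + P1 *m (A + B *m K1) =
    - ((C + D *m K1)^T *m (C + D *m K1) + 1%:M) ->
  0 < e < 1 ->
  exists Ke Pe,
    [/\ hurwitz (A + B *m Ke),
        forall v, quadform ((A + B *m Ke)^T *m Pe + Pe *m (A + B *m Ke)) v <=
          - quadform ((C + D *m Ke)^T *m (C + D *m Ke)) v &
        forall x, quadform Pe x <= (1 - e) * quadform P x + e * quadform P1 x].
Proof.
move=> [Pd [_ PM]] P1d P1E /andP[e0 e1]; have e1' : 0 < 1 - e by rewrite subr_gt0.
have Pu := posdef_unit Pd; have P1u := posdef_unit P1d.
pose Q := invmx P; pose Q1 := invmx P1.
have Qd : posdef Q := posdef_inv Pd; have Q1d : posdef Q1 := posdef_inv P1d.
pose Qe := (1 - e) *: Q + e *: Q1.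
have Qed : posdef Qe.
  by apply: posdefDl; [apply/posdef_psd/posdefZ | apply: posdefZ].
have Qeu := posdef_unit Qed; pose Pe := invmx Qe.
have Ped : posdef Pe := posdef_inv Qed.
have Peu := posdef_unit Ped.
pose Ke := ((1 - e) *: (K *m Q) + e *: (K1 *m Q1)) *m Pe.
(* Closed-loop matrices act on v = Qe y, with y = Pe v, through the two points
   Q y and Q1 y. *)
have key m (F : 'M[R]_(m, q)) (G : 'M[R]_(m, r)) v :
    (F + G *m Ke) *m v = (1 - e) *: ((F + G *m K) *m (Q *m (Pe *m v)))
      + e *: ((F + G *m K1) *m (Q1 *m (Pe *m v))).
  have vE : v = (1 - e) *: (Q *m (Pe *m v)) + e *: (Q1 *m (Pe *m v)).
    by rewrite !scalemxAl -mulmxDl mulKVmx.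
  have KE : Ke *m v =
      (1 - e) *: (K *m (Q *m (Pe *m v))) + e *: (K1 *m (Q1 *m (Pe *m v))).
    by rewrite /Ke -mulmxA mulmxDl -!scalemxAl !mulmxA.
  rewrite mulmxDl -mulmxA KE {1}vE !mulmxDr -!scalemxAr.
  by rewrite [in RHS]mulmxDl [in X in _ = _ + X]mulmxDl !scalerDr addrACA !mulmxA.
have formE (L : 'M[R]_q) (X : 'M[R]_q) w : posdef X ->
    quadform (L^T *m X + X *m L) w = 2 * bilform 1%:M (L *m w) (X *m w).
  move=> Xd; rewrite quadform_lyap ?Xd.1//.
  by rewrite /bilform mulmx1 mulmxA.
have main v : quadform ((A + B *m Ke)^T *m Pe + Pe *m (A + B *m Ke)) v <=
    - quadform ((C + D *m Ke)^T *m (C + D *m Ke)) v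
    - e * quadform 1%:M (Q1 *m (Pe *m v)).
  rewrite formE// quadform_gram !key.
  set y := Pe *m v; set w := Q *m y; set w1 := Q1 *m y.
  have yE : y = P *m w by rewrite /w mulKVmx.
  have y1E : y = P1 *m w1 by rewrite /w1 mulKVmx.
  have h : 2 * bilform 1%:M ((A + B *m K) *m w) y <=
      - quadform 1%:M ((C + D *m K) *m w).
    rewrite yE -formE// -quadform_gram.
    by have := PM w; rewrite sub0r quadformN oppr_ge0 quadformD; lra.
  have h1 : 2 * bilform 1%:M ((A + B *m K1) *m w1) y =
      - quadform 1%:M ((C + D *m K1) *m w1) - quadform 1%:M w1.
    by rewrite y1E -formE// P1E quadformN quadformD quadform_gram opprD.
  have conv := quadform1_convex ((C + D *m K) *m w) ((C + D *m K1) *m w1)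
    (e := e).
  have {}conv := conv ltac:(by rewrite (ltW e0) (ltW e1)).
  have : (1 - e) * (2 * bilform 1%:M ((A + B *m K) *m w) y) <=
      (1 - e) * - quadform 1%:M ((C + D *m K) *m w) by rewrite ler_pM2l.
  have := congr1 ( *%R e) h1; rewrite bilform_linl; lra.
exists Ke, Pe; split.
- apply: (lyapunov_hurwitz Ped (N := e *: ((Q1 *m Pe)^T *m (Q1 *m Pe)))).
    apply: posdefZ => //; split; first exact: (psd_gram _).1.
    move=> v v0; rewrite quadform_gram; apply: (posdef1 R q).2.
    apply: contra_neq v0; rewrite -mulmxA => h; rewrite -[v](mulKmx Peu).
    have Q1u := posdef_unit Q1d.
    by rewrite -[Pe *m v](mulKmx Q1u) h !mulmx0.
  move=> v; apply: le_trans (main v) _.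
  rewrite quadformZ [in leRHS]quadform_gram -mulmxA gerDr oppr_le0.
  exact: (psd_gram _).2.
- move=> v; apply: le_trans (main v) _; rewrite gerBl.
  by rewrite mulr_ge0 ?(ltW e0)//; exact: quadform1_ge0.
- move=> x.
  have E := posdef_fenchel_eq x Ped.
  have F := posdef_fenchel_young x (Pe *m x) Pd.
  have F1 := posdef_fenchel_young x (Pe *m x) P1d.
  move: E; rewrite {2}/Pe invmxK /Qe quadform_conv -/Q -/Q1.
  move: F F1; rewrite -/Q -/Q1.
  set a := bilform _ _ _; set b := quadform P x; set c := quadform P1 x.
  set d := quadform Q _; set f := quadform Q1 _ => F F1 E.
  have : (1 - e) * (2 * a) <= (1 - e) * (b + d) by rewrite ler_pM2l.
  have : e * (2 * a) <= e * (c + f) by rewrite ler_pM2l.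
  lra.
Qed.

End ConvexCombination.

(** * From the semidefinite program to certificates *)

Section SDP.
Variable R : realType.

Lemma quadformNv n (P : 'M[R]_n) v : quadform P (- v) = quadform P v.
Proof.
by rewrite /quadform [(- v)^T]linearN /= mulNmx mulmxN mulNmx opprK.
Qed.

Lemma quadform_block m n (Zb : 'M[R]_m) (Zu : 'M[R]_(m, n)) (Zn : 'M[R]_n) a b :
  quadform (block_mx Zb Zu Zu^T Zn) (col_mx a b) =
  quadform Zb a + 2 * (a^T *m Zu *m b) 0 0 + quadform Zn b.
Proof.
rewrite /quadform tr_col_mx mul_row_block mul_row_col !mulmxDl !mxE.
have -> : \sum_j (b^T *m Zu^T) 0 j * a j 0 = \sum_j (a^T *m Zu) 0 j * b j 0.
  have /matrixP/(_ 0 0) : b^T *m Zu^T *m a = (a^T *m Zu *m b)^T.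
    by rewrite !trmx_mul trmxK mulmxA.
  by rewrite !mxE.
by ring.
Qed.

Lemma psd_block_dr m n (Zb : 'M[R]_m) (Zu : 'M[R]_(m, n)) (Zn : 'M[R]_n) :
  possemidef (block_mx Zb Zu Zu^T Zn) -> possemidef Zn.
Proof.
move=> [Zs Zp]; split.
  by move: Zs; rewrite tr_block_mx => /eq_block_mx[_ _ _].
move=> b; have := Zp (col_mx 0 b).
by rewrite quadform_block quadformv0 trmx0 !mul0mx mxE mulr0 !add0r.
Qed.

Lemma psd_block_ul m n (Zb : 'M[R]_m) (Zu : 'M[R]_(m, n)) (Zn : 'M[R]_n) :
  possemidef (block_mx Zb Zu Zu^T Zn) -> Zb^T = Zb.
Proof. by move=> [+ _]; rewrite tr_block_mx => /eq_block_mx[]. Qed.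

(** The Schur complement, for a gain [K] with [Zu = K Zn]. *)
Lemma psd_block_schur m n (Zb : 'M[R]_m) (Zn : 'M[R]_n) (K : 'M[R]_(m, n)) :
  possemidef (block_mx Zb (K *m Zn) (K *m Zn)^T Zn) ->
  possemidef (Zb - K *m Zn *m K^T).
Proof.
move=> Zp; have Zns := (psd_block_dr Zp).1; have Zbs := psd_block_ul Zp.
split.
  have -> : (Zb - K *m Zn *m K^T)^T = Zb^T - (K *m Zn *m K^T)^T.
    by apply/matrixP => i j; rewrite !mxE.
  by rewrite !trmx_mul trmxK Zbs Zns mulmxA.
move=> a; have := Zp.2 (col_mx a (- (K^T *m a))).
rewrite quadform_block quadformB.
have -> : quadform (K *m Zn *m K^T) a = quadform Zn (K^T *m a).
  by rewrite -quadform_congr trmxK.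
have -> : (a^T *m (K *m Zn) *m - (K^T *m a)) 0 0 = - quadform Zn (K^T *m a).
  by rewrite /quadform trmx_mul trmxK mulmxN mxE !mulmxA.
rewrite quadformNv; lra.
Qed.

(** The block matrix [[K; 1] Zn [K; 1]^T] of the covariance [Zn] under the
    feedback [K]. *)
Lemma psd_feedback_block m n (K : 'M[R]_(m, n)) (Zn : 'M[R]_n) :
  possemidef Zn ->
  possemidef (block_mx (K *m Zn *m K^T) (K *m Zn) (K *m Zn)^T Zn).
Proof.
move=> Znp; have := psd_congr (row_mx K^T 1%:M) Znp.
rewrite tr_row_mx trmxK tr_scalar_mx mul_col_mx mul1mx mul_col_row !mulmx1.
by rewrite trmx_mul Znp.1.
Qed.

Lemma mxinner_gram m n (G : 'M[R]_(m, n)) Z :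
  mxinner (G^T *m G) Z = \tr (G^T *m G *m Z).
Proof. by rewrite /mxinner trmx_mul trmxK. Qed.

(** The operators [P |-> A^T P + P A] and [Z |-> A Z + Z A^T] are adjoint for
    the trace pairing. *)
Lemma tr_lyapunov n (A P Z : 'M[R]_n) :
  \tr ((A^T *m P + P *m A) *m Z) = \tr (P *m (A *m Z + Z *m A^T)).
Proof.
rewrite mulmxDl mulmxDr !mxtraceD addrC; congr (_ + _); first by rewrite mulmxA.
by rewrite -mulmxA mxtrace_mulC mulmxA.
Qed.

Variables (q r p : nat) (A : 'M[R]_q) (B : 'M[R]_(q, r)).
Variables (C : 'M[R]_(p, q)) (D : 'M[R]_(p, r)).
Hypothesis DC : D^T *m C = 0.

(** The gram matrix of the closed-loop output has no cross terms. *)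
Lemma output_gram (K : 'M[R]_(r, q)) :
  (C + D *m K)^T *m (C + D *m K) = C^T *m C + K^T *m (D^T *m D) *m K.
Proof.
have CD : C^T *m D = 0 by rewrite -[LHS]trmxK trmx_mul trmxK DC trmx0.
have -> : (C + D *m K)^T = C^T + K^T *m D^T.
  by rewrite -trmx_mul; apply/matrixP => i j; rewrite !mxE.
rewrite mulmxDl !mulmxDr -!mulmxA DC mulmx0 (mulmxA C^T) CD mul0mx.
by rewrite addr0 add0r !mulmxA.
Qed.

Lemma tr_output_gram (K : 'M[R]_(r, q)) (Z : 'M[R]_q) :
  \tr ((C + D *m K)^T *m (C + D *m K) *m Z) =
  mxinner (C^T *m C) Z + mxinner (D^T *m D) (K *m Z *m K^T).
Proof.
rewrite output_gram mulmxDl mxtraceD !mxinner_gram; congr (_ + _).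
by rewrite -mulmxA -mulmxA mxtrace_mulC !mulmxA.
Qed.

(** A feasible point [Z] of the semidefinite program whose block [Zn] is
    positive definite, with a strictly negative right-hand side, yields the
    gain [Zu Zn^-1] and a certificate of nearly the same value. *)
Lemma sdp_certificate (x0 : 'cV[R]_q) (Zb : 'M[R]_r) (Zu : 'M[R]_(r, q))
    (Zn : 'M[R]_q) (e : R) : 0 < e ->
  possemidef (block_mx Zb Zu Zu^T Zn) -> posdef Zn ->
  Zu^T *m B^T + B *m Zu + Zn *m A^T + A *m Zn = - (x0 *m x0^T + e%:M) ->
  exists K P, lyapunov_cert A B C D K P /\
    quadform P x0 <=
    mxinner (C^T *m C) Zn + mxinner (D^T *m D) Zb + e * \tr Zn.
Proof.
move=> e0 Zp Znd ZE; have Znu := posdef_unit Znd; have Zns := Znd.1.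
pose K := Zu *m invmx Zn.
have ZuE : Zu = K *m Zn by rewrite /K mulmxKV.
set Acl := A + B *m K.
have e1E : e%:M = e *: (1%:M : 'M[R]_q) by rewrite scalemx1.
have e1d : posdef (e%:M : 'M[R]_q) by rewrite e1E; apply: posdefZ (posdef1 _ _).
have AclE : Acl *m Zn + Zn *m Acl^T = - (x0 *m x0^T + e%:M).
  rewrite -ZE ZuE trmx_mul Zns /Acl mulmxDl.
  have -> : (A + B *m K)^T = A^T + K^T *m B^T.
    by rewrite -trmx_mul; apply/matrixP => i j; rewrite !mxE.
  by rewrite mulmxDr !mulmxA; apply/matrixP => i j; rewrite !mxE; ring.
(* Zn is a strict Lyapunov function for the transpose of Acl. *)
have hAcl : hurwitz Acl.
  rewrite -[Acl]trmxK; apply: hurwitz_tr; apply: (lyapunov_hurwitz Znd e1d) => v.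
  rewrite trmxK AclE quadformN lerN2 quadformD lerDr.
  exact: (psd_outer _).2.
set M := (C + D *m K)^T *m (C + D *m K).
have Md : posdef (M + e%:M) by apply: posdefDl => //; exact: psd_gram.
have [P Ps PE] := hurwitz_lyapunov_solve hAcl Md.1.
have Pd := hurwitz_lyapunov_posdef hAcl Md Ps PE.
exists K, P; split.
  split=> //; rewrite /loewner_le PE sub0r -/M opprD opprK addrAC subrr add0r.
  exact: posdef_psd.
rewrite -tr_mul_outer.
apply: (@le_trans _ _ (\tr (P *m (x0 *m x0^T + e%:M)))).
  rewrite mulmxDr mxtraceD lerDl mul_mx_scalar mxtraceZ.
  by rewrite mulr_ge0 ?(ltW e0)//; exact/psd_tr_ge0/posdef_psd.
rewrite -[x0 *m _ + _]opprK -AclE mulmxN [\tr (- _)]raddfN /= -tr_lyapunov PE.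
rewrite mulNmx [\tr (- _)]raddfN /= opprK mulmxDl mxtraceD mul_scalar_mx mxtraceZ.
rewrite tr_output_gram lerD2r lerD2l !mxinner_gram -subr_ge0.
rewrite -raddfB /= -mulmxBr; apply: psd_tr_gram_ge0.
by apply: psd_block_schur; rewrite -ZuE.
Qed.

Variables (K1 : 'M[R]_(r, q)).
Hypothesis hK1 : hurwitz (A + B *m K1).

(** Every value of the semidefinite program is approximated from above by
    certified values. *)
Lemma sdp_certificate_approx (x0 : 'cV[R]_q) (Zb : 'M[R]_r) (Zu : 'M[R]_(r, q))
    (Zn : 'M[R]_q) :
  possemidef (block_mx Zb Zu Zu^T Zn) ->
  Zu^T *m B^T + B *m Zu + Zn *m A^T + A *m Zn = - (x0 *m x0^T) ->
  exists c, forall e, 0 < e <= 1 -> exists K P, lyapunov_cert A B C D K P /\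
    quadform P x0 <= mxinner (C^T *m C) Zn + mxinner (D^T *m D) Zb + e * c.
Proof.
move=> Zp ZE.
have [W Ws WE] := hurwitz_lyapunov_solve (hurwitz_tr hK1) (tr_scalar_mx q 1).
have Wd := hurwitz_lyapunov_posdef (hurwitz_tr hK1) (posdef1 R q) Ws WE.
rewrite trmxK in WE.
have Wp := psd_feedback_block K1 (posdef_psd Wd).
have Znp := psd_block_dr Zp.
exists (mxinner (C^T *m C) W + mxinner (D^T *m D) (K1 *m W *m K1^T)
  + \tr Zn + \tr W) => e /andP[e0 e1].
have [|||K [P [KP Px]]] := @sdp_certificate x0
    (Zb + e *: (K1 *m W *m K1^T)) (Zu + e *: (K1 *m W)) (Zn + e *: W) e e0.
- have := psdD Zp (psdZ (ltW e0) Wp).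
  rewrite scale_block_mx add_block_mx.
  by have -> : (Zu + e *: (K1 *m W))^T = Zu^T + e *: (K1 *m W)^T
    by apply/matrixP => i j; rewrite !mxE.
- by apply: posdefDl => //; exact: posdefZ.
- rewrite opprD -ZE -[e%:M]scalemx1 -scalerN -WE.
  have -> : (Zu + e *: (K1 *m W))^T = Zu^T + e *: (W *m K1^T).
    by rewrite -{2}Ws -trmx_mul; apply/matrixP => i j; rewrite !mxE.
  have -> : (A + B *m K1)^T = A^T + K1^T *m B^T.
    by rewrite -trmx_mul; apply/matrixP => i j; rewrite !mxE.
  rewrite !mulmxDl !mulmxDr -!scalemxAl -!scalemxAr !mulmxA.
  by apply/matrixP => i j; rewrite !mxE; ring.
exists K, P; split=> //; apply: le_trans Px _.
rewrite /mxinner !mulmxDr !mxtraceD -!scalemxAr !mxtraceZ -!/(mxinner _ _).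
have t0 := psd_tr_ge0 (posdef_psd Wd).
set a := mxinner _ _; set b := mxinner _ _; set c := mxinner _ _.
set d := mxinner _ _.
have : e * e * \tr W <= e * \tr W by rewrite ler_wpM2r// ler_piMl// ltW.
lra.
Qed.

End SDP.

(** * Integrals of matrix-valued functions *)

Section MatrixIntegral.
Variable R : realType.
Local Open Scope classical_set_scope.
Local Notation mu := (@lebesgue_measure R).

Lemma integrable_lincomb (D : set R) (mD : measurable D) (I : Type) (s : seq I)
    (c : I -> R) (f : I -> R -> R) :
  (forall i, mu.-integrable D (EFin \o f i)) ->
  mu.-integrable D (EFin \o (fun t => \sum_(i <- s) c i * f i t)) /\
  \int[mu]_(t in D) (\sum_(i <- s) c i * f i t) =
    \sum_(i <- s) c i * \int[mu]_(t in D) f i t.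
Proof.
move=> fi; elim: s => [|i s [IH1 IH2]].
  split.
    rewrite (_ : EFin \o _ = cst 0%E); first exact: integrable0.
    by apply/funext => t /=; rewrite big_nil.
  rewrite big_nil; under eq_Rintegral do rewrite big_nil.
  by rewrite Rintegral_cst// mul0r.
have ci : mu.-integrable D (EFin \o (fun t => c i * f i t)).
  rewrite (_ : EFin \o _ = (fun t => (c i)%:E * (EFin \o f i) t)%E).
    exact: integrableZl.
  by apply/funext => t.
split.
  rewrite (_ : EFin \o _ = ((EFin \o (fun t => (c i * f i t)%R)) \+
      (EFin \o (fun t => (\sum_(j <- s) c j * f j t)%R)))%E).
    exact: integrableD.
  by apply/funext => t /=; rewrite big_cons.
rewrite big_cons; under eq_Rintegral do rewrite big_cons.
by rewrite RintegralD// RintegralZl// IH2.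
Qed.

(** Entrywise integrability over [[0, T]]. *)
Definition mx_integrable m n (T : R) (F : R -> 'M[R]_(m, n)) : Prop :=
  forall i j, mu.-integrable `[0, T] (EFin \o (fun t => F t i j)).

(** The entrywise integral over [[0, T]]. *)
Definition int_mx m n (T : R) (F : R -> 'M[R]_(m, n)) : 'M[R]_(m, n) :=
  \matrix_(i, j) \int[mu]_(t in `[0, T]) F t i j.

(** Integration commutes with linear forms on matrices. *)
Lemma scalar_int_mx m n (T : R) (F : R -> 'M[R]_(m, n))
    (phi : 'M[R]_(m, n) -> R) :
  scalar phi -> mx_integrable T F ->
  mu.-integrable `[0, T] (EFin \o (fun t => phi (F t))) /\
  phi (int_mx T F) = \int[mu]_(t in `[0, T]) phi (F t).
Proof.
move=> phil Fi.
have phi0 : phi 0 = 0.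
  by have := phil (-1) 0 0; rewrite scaler0 addr0 mulN1r addNr.
have phiD : {morph phi : x y / x + y}.
  by move=> x y; have := phil 1 x y; rewrite scale1r mul1r.
have phiZ a x : phi (a *: x) = a * phi x.
  by have := phil a x 0; rewrite !addr0 phi0 addr0.
have phiE X : phi X =
    \sum_(ij : 'I_m * 'I_n) phi (delta_mx ij.1 ij.2) * X ij.1 ij.2.
  rewrite {1}(matrix_sum_delta X) (big_morph phi phiD phi0).
  rewrite -(pair_bigA _ (fun i j => phi (delta_mx i j) * X i j)) /=.
  apply: eq_bigr => i _; rewrite (big_morph phi phiD phi0); apply: eq_bigr => j _.
  by rewrite phiZ mulrC.
have mD : measurable `[0, T] by exact: measurable_itv.
have [] := @integrable_lincomb _ mD _ (index_enum _)
  (fun ij => phi (delta_mx ij.1 ij.2)) (fun ij t => F t ij.1 ij.2)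
  (fun ij => Fi ij.1 ij.2).
have -> : (fun t =>
      \sum_(ij : 'I_m * 'I_n) phi (delta_mx ij.1 ij.2) * F t ij.1 ij.2)
    = (fun t => phi (F t)).
  by apply/funext => t; rewrite [RHS]phiE.
move=> h1 h2; split => //; rewrite h2 phiE; apply: eq_bigr => ij _.
by rewrite mxE.
Qed.

Lemma mulmx_integrable m n l (T : R) (G : 'M[R]_(m, n)) (F : R -> 'M[R]_(n, l)) :
  mx_integrable T F -> mx_integrable T (fun t => G *m F t).
Proof.
move=> Fi i j.
by apply: (scalar_int_mx (phi := fun X => (G *m X) i j) _ Fi).1 => a X Y;
  rewrite mulmxDr -scalemxAr !mxE.
Qed.

Lemma add_mx_integrable m n (T : R) (F G : R -> 'M[R]_(m, n)) :
  mx_integrable T F -> mx_integrable T G ->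
  mx_integrable T (fun t => F t + G t).
Proof.
move=> Fi Gi i j.
rewrite (_ : EFin \o _ = ((EFin \o (fun t => F t i j)) \+
  (EFin \o (fun t => G t i j)))%E); first exact: integrableD.
by apply/funext => t /=; rewrite mxE.
Qed.

Lemma measurable_mulmx m n (D : set R) (G : 'M[R]_(m, n)) (x : R -> 'cV[R]_n) :
  (forall k, measurable_fun D (fun t => x t k 0)) ->
  forall k, measurable_fun D (fun t => (G *m x t) k 0).
Proof.
move=> mx k.
rewrite (_ : (fun t => _) = fun t => \sum_j G k j * x t j 0); last first.
  by apply/funext => t; rewrite mxE.
by apply: measurable_sum => j; apply: measurable_funM => //; exact: measurable_cst.
Qed.

Lemma measurable_quadform1 n (D : set R) (x : R -> 'cV[R]_n) :
  (forall k, measurable_fun D (fun t => x t k 0)) ->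
  measurable_fun D (fun t => quadform 1%:M (x t)).
Proof.
move=> mx.
rewrite (_ : (fun t => _) = fun t => \sum_j x t j 0 ^+ 2); last first.
  by apply/funext => t; rewrite quadform1E.
by apply: measurable_sum => j; apply: measurable_funX.
Qed.

End MatrixIntegral.

(** * From trajectories to the semidefinite program *)

Section TrajectorySDP.
Variable R : realType.
Local Open Scope classical_set_scope.
Local Notation mu := (@lebesgue_measure R).
Variables (q r p : nat) (A : 'M[R]_q) (B : 'M[R]_(q, r)).
Variables (C : 'M[R]_(p, q)) (D : 'M[R]_(p, r)).
Hypothesis DC : D^T *m C = 0.
Variables (Pi : 'M[R]_r) (L : 'M[R]_(r, p)).
Hypotheses (BPi : B *m Pi = B) (DPi : D *m Pi = D).
Hypotheses (LC : L *m C = 0) (LD : L *m D = Pi).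
Variables (x0 : 'cV[R]_q) (u : R -> 'cV[R]_r) (x : R -> 'cV[R]_q).
Hypothesis xu : trajectory A B x0 u x.

Let z t := C *m x t + D *m u t.
Let w t := Pi *m u t.

Lemma trajectory_init : x 0 = x0.
Proof.
have [_ _ xE] := xu; apply/matrixP => k j; rewrite ord1 xE//.
by rewrite set_itv1 Rintegral_set1 addr0.
Qed.

Lemma trajectory_continuous T k : {within `[0, T], continuous (fun t => x t k 0)}.
Proof.
have [_ xc _] := xu; apply: continuous_subspaceW (xc k).
by apply: subset_itvl; rewrite bnd_simp.
Qed.

Lemma trajectory_input_integrable T : 0 <= T -> mx_integrable T u.
Proof. by move=> T0 k j; rewrite ord1; have [ui _ _] := xu; exact: ui. Qed.

Lemma trajectory_state_integrable T : mx_integrable T x.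
Proof.
move=> k j; rewrite ord1; apply: continuous_compact_integrable.
  exact: segment_compact.
exact: trajectory_continuous.
Qed.

Lemma output_measurable k :
  measurable_fun `[(0 : R), +oo[ (fun t => z t k 0).
Proof.
have [ui xc _] := xu.
have mu_ j : measurable_fun `[(0 : R), +oo[ (fun t => u t j 0).
  rewrite itv_bndy_bigcup_BRight.
  apply/measurable_fun_bigcup => [n|n]; first exact: measurable_itv.
  have n0 : 0 <= 0 + n%:R :> R by rewrite add0r.
  by apply/measurable_EFinP; case/integrableP: (ui j _ n0).
have mx_ j : measurable_fun `[(0 : R), +oo[ (fun t => x t j 0).
  by apply: subspace_continuous_measurable_fun; [exact: measurable_itv|exact: xc].
rewrite (_ : (fun t => _) =
    (fun t => (C *m x t) k 0 + (D *m u t) k 0)); last first.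
  by apply/funext => t; rewrite /z mxE.
by apply: measurable_funD; exact: measurable_mulmx.
Qed.

Lemma energyE : energy C D u x =
  (\int[mu]_(t in `[0%R, +oo[) (quadform 1%:M (z t))%:E)%E.
Proof.
by rewrite /energy; apply: eq_integral => t _; rewrite /quadform mulmx1.
Qed.

Hypothesis energy_fin : (energy C D u x < +oo)%E.

Lemma output_integrable T : 0 <= T ->
  mu.-integrable `[0, T] (EFin \o (fun t => quadform 1%:M (z t))) /\
  \int[mu]_(t in `[0, T]) quadform 1%:M (z t) <= fine (energy C D u x).
Proof.
move=> T0.
have mz := measurable_quadform1 output_measurable.
have sub : `[0, T] `<=` `[0%R, +oo[ by apply: subset_itvl; rewrite bnd_simp.
have le : (\int[mu]_(t in `[0%R, T]) (quadform 1%:M (z t))%:E <= energy C D u x)%E.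
  rewrite energyE; apply: ge0_subset_integral => //=.
  - exact/measurable_EFinP.
  - by move=> t _; rewrite lee_fin quadform1_ge0.
have i : mu.-integrable `[0, T] (EFin \o (fun t => quadform 1%:M (z t))).
  apply/integrableP; split.
    by apply/measurable_EFinP; exact: measurable_funS mz.
  apply: le_lt_trans energy_fin; apply: le_trans le.
  rewrite le_eqVlt; apply/orP; left; apply/eqP; apply: eq_integral => t _ /=.
  by rewrite ger0_norm ?quadform1_ge0.
split => //; rewrite /Rintegral fine_le//.
  exact: integrable_fin_num.
rewrite ge0_fin_numE// energyE integral_ge0// => t _.
by rewrite lee_fin quadform1_ge0.
Qed.

(** The input itself need not be square integrable, but its projection is a
    linear image of the output. *)
Lemma projected_inputE t : w t = L *m z t.
Proof. by rewrite /z mulmxDr !mulmxA LC LD mul0mx add0r. Qed.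

Lemma projected_input_measurable T k :
  measurable_fun `[(0 : R), T] (fun t => w t k 0).
Proof.
rewrite (_ : (fun t => _) = (fun t => (L *m z t) k 0)); last first.
  by apply/funext => t; rewrite projected_inputE.
apply: measurable_mulmx => j; apply: measurable_funS (output_measurable j) => //.
by apply: subset_itvl; rewrite bnd_simp.
Qed.

Lemma covariance_integrable T : 0 <= T ->
  mx_integrable T (fun t => col_mx (w t) (x t) *m (col_mx (w t) (x t))^T).
Proof.
move=> T0.
have wi : mx_integrable T w by apply/mulmx_integrable/trajectory_input_integrable.
(* Products with a continuous state component are integrable; products of two
   projected inputs are dominated by the square of the output. *)
have wx i j : mu.-integrable `[0, T] (EFin \o (fun t => w t i 0 * x t j 0)).
  by apply: integrableM_continuous (wi i 0) _; exact: trajectory_continuous.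
have ww i j : mu.-integrable `[0, T] (EFin \o (fun t => w t i 0 * w t j 0)).
  apply: (@le_integrable _ _ _ mu _ _ _
    (EFin \o (fun t => \tr (L^T *m L) * quadform 1%:M (z t)))).
  - exact: measurable_itv.
  - apply/measurable_EFinP; apply: measurable_funM;
      exact: projected_input_measurable.
  - move=> t _; rewrite /= lee_fin.
    have LL0 := psd_tr_ge0 (psd_gram L).
    rewrite [leRHS]ger0_norm ?mulr_ge0 ?quadform1_ge0//.
    have wb k : w t k 0 ^+ 2 <= \tr (L^T *m L) * quadform 1%:M (z t).
      apply: le_trans (psd_upper _ (psd_gram L)).
      by rewrite quadform_gram -projected_inputE sqr_le_quadform1.
    have := wb i; have := wb j; rewrite ler_norml.
    have := sqr_ge0 (w t i 0 + w t j 0); have := sqr_ge0 (w t i 0 - w t j 0).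
    by move=> *; apply/andP; split; nra.
  - have -> : EFin \o (fun t => \tr (L^T *m L) * quadform 1%:M (z t)) =
      (fun t => (\tr (L^T *m L))%:E * (EFin \o (fun t => quadform 1%:M (z t))) t)%E.
      by apply/funext => t.
    by apply: integrableZl => //; exact: (output_integrable T0).1.
move=> i j.
rewrite (_ : (fun t => _) =
    (fun t => col_mx (w t) (x t) i 0 * col_mx (w t) (x t) j 0)).
  case: (splitP i) => i' ii'; case: (splitP j) => j' jj'.
  - have -> : i = lshift q i' by apply/val_inj.
    have -> : j = lshift q j' by apply/val_inj.
    rewrite (_ : (fun t => _) = (fun t => w t i' 0 * w t j' 0))//.
    by apply/funext => t; rewrite !col_mxEu.
  - have -> : i = lshift q i' by apply/val_inj.
    have -> : j = rshift r j' by apply/val_inj.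
    rewrite (_ : (fun t => _) = (fun t => w t i' 0 * x t j' 0))//.
    by apply/funext => t; rewrite col_mxEu col_mxEd.
  - have -> : i = rshift r i' by apply/val_inj.
    have -> : j = lshift q j' by apply/val_inj.
    rewrite (_ : (fun t => _) = (fun t => w t j' 0 * x t i' 0))//.
    by apply/funext => t; rewrite col_mxEu col_mxEd mulrC.
  - have -> : i = rshift r i' by apply/val_inj.
    have -> : j = rshift r j' by apply/val_inj.
    rewrite (_ : (fun t => _) = (fun t => x t i' 0 * x t j' 0))//.
      apply: integrableM_continuous; last exact: trajectory_continuous.
      exact: (trajectory_state_integrable T i' 0).
    by apply/funext => t; rewrite !col_mxEd.
by apply/funext => t; rewrite outer_mxE.
Qed.

(** The covariance [int_0^T v v^T] of [v = (Pi u, x)] is feasible up to the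
    contribution of the endpoint [x T], by the product rule, and its cost is
    the energy spent up to time [T]. *)
Lemma trajectory_covariance T : 0 <= T ->
  exists (Zb : 'M[R]_r) (Zu : 'M[R]_(r, q)) (Zn : 'M[R]_q),
    [/\ possemidef (block_mx Zb Zu Zu^T Zn),
        Zu^T *m B^T + B *m Zu + Zn *m A^T + A *m Zn =
          x T *m (x T)^T - x0 *m x0^T &
        mxinner (C^T *m C) Zn + mxinner (D^T *m D) Zb <=
          fine (energy C D u x)].
Proof.
move=> T0; have vi := covariance_integrable T0.
set V := fun t => col_mx (w t) (x t) *m (col_mx (w t) (x t))^T in vi.
have VE t : V t = block_mx (w t *m (w t)^T) (w t *m (x t)^T)
    (x t *m (w t)^T) (x t *m (x t)^T) by rewrite /V tr_col_mx mul_col_row.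
set Z := int_mx T V.
have Zs : Z^T = Z.
  apply/matrixP => i j; rewrite !mxE; apply: eq_Rintegral => t _.
  by rewrite !outer_mxE mulrC.
have ZE : Z = block_mx (ulsubmx Z) (ursubmx Z) (ursubmx Z)^T (drsubmx Z).
  by rewrite trmx_ursub Zs submxK.
exists (ulsubmx Z), (ursubmx Z), (drsubmx Z); split.
- rewrite -ZE; split=> // y.
  rewrite (scalar_int_mx (phi := fun X => quadform X y) _ vi).2; last first.
    by move=> a X Y; rewrite quadformD quadformZ.
  by apply: Rintegral_ge0 => t _; rewrite quadform_outer sqr_ge0.
- apply/matrixP => i j.
  pose phi (X : 'M[R]_(r + q)) := ((ursubmx X)^T *m B^T + B *m ursubmx X +
    drsubmx X *m A^T + A *m drsubmx X) i j.
  have phil : scalar phi.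
    move=> a X Y; rewrite /phi.
    have -> : ursubmx (a *: X + Y) = a *: ursubmx X + ursubmx Y.
      by apply/matrixP => k l; rewrite !mxE.
    have -> : drsubmx (a *: X + Y) = a *: drsubmx X + drsubmx Y.
      by apply/matrixP => k l; rewrite !mxE.
    have -> : (a *: ursubmx X + ursubmx Y)^T = a *: (ursubmx X)^T + (ursubmx Y)^T.
      by apply/matrixP => k l; rewrite !mxE.
    rewrite !mulmxDl !mulmxDr -!scalemxAl -!scalemxAr.
    by rewrite !mxE; ring.
  rewrite -[LHS]/(phi Z) (scalar_int_mx phil vi).2.
  pose f t := A *m x t + B *m u t.
  have fi : mx_integrable T f.
    apply: add_mx_integrable; apply: mulmx_integrable.
      exact: trajectory_state_integrable.
    exact: trajectory_input_integrable.
  have phiV t : phi (V t) = f t i 0 * x t j 0 + f t j 0 * x t i 0.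
    rewrite /phi VE block_mxKur block_mxKdr.
    have fE : f t = A *m x t + B *m w t by rewrite /w mulmxA BPi.
    have -> : (w t *m (x t)^T)^T *m B^T + B *m (w t *m (x t)^T) +
        x t *m (x t)^T *m A^T + A *m (x t *m (x t)^T) =
        f t *m (x t)^T + x t *m (f t)^T.
      have -> : (f t)^T = (x t)^T *m A^T + (w t)^T *m B^T.
        by rewrite -!trmx_mul fE; apply/matrixP => k l; rewrite !mxE.
      rewrite fE trmx_mul trmxK mulmxDl mulmxDr !mulmxA.
      by apply/matrixP => k l; rewrite !mxE; ring.
    by rewrite [LHS]mxE !outer_mxE; congr (_ + _); rewrite mulrC.
  have [_ _ xE] := xu.
  under eq_Rintegral do rewrite phiV.
  rewrite (@Rintegral_product_rule _ (fun t => f t i 0) (fun t => f t j 0)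
    (fun t => x t i 0) (fun t => x t j 0))//.
  + by rewrite trajectory_init [RHS]mxE outer_mxE [X in _ = _ + X]mxE outer_mxE.
  + exact: trajectory_continuous.
  + exact: trajectory_continuous.
  + by move=> t /andP[t0 _]; rewrite trajectory_init xE.
  + by move=> t /andP[t0 _]; rewrite trajectory_init xE.
- have [zi zle] := output_integrable T0; apply: le_trans zle.
  pose phi (X : 'M[R]_(r + q)) :=
    mxinner (C^T *m C) (drsubmx X) + mxinner (D^T *m D) (ulsubmx X).
  have phil : scalar phi.
    move=> a X Y; rewrite /phi /mxinner.
    have -> : ulsubmx (a *: X + Y) = a *: ulsubmx X + ulsubmx Y.
      by apply/matrixP => k l; rewrite !mxE.
    have -> : drsubmx (a *: X + Y) = a *: drsubmx X + drsubmx Y.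
      by apply/matrixP => k l; rewrite !mxE.
    rewrite !mulmxDr -!scalemxAr.
    by rewrite !mxtraceD !mxtraceZ; ring.
  rewrite -[leLHS]/(phi Z) (scalar_int_mx phil vi).2.
  rewrite le_eqVlt; apply/orP; left; apply/eqP; apply: eq_Rintegral => t _.
  rewrite /phi VE block_mxKul block_mxKdr !mxinner_gram !tr_mul_outer.
  rewrite !quadform_gram.
  have -> : D *m w t = D *m u t by rewrite /w mulmxA DPi.
  rewrite /z -[C *m x t]scale1r -[D *m u t]scale1r quadform_lin ?tr_scalar_mx//.
  rewrite !scale1r /bilform mulmx1 trmx_mul.
  have -> : (x t)^T *m C^T *m (D *m u t) = 0.
    rewrite !mulmxA -(mulmxA _ C^T) -[C^T *m D]trmxK trmx_mul trmxK DC.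
    by rewrite trmx0 mulmx0 mul0mx.
  by rewrite mxE; ring.
Qed.

End TrajectorySDP.

(** * Equality of the three values *)

Section Values.
Variable R : realType.
Local Open Scope classical_set_scope.

(** An upper bound up to an error linear in [e] holds without the error. *)
Lemma lee_approx (a : \bar R) (b c : R) :
  (forall e, 0 < e < 1 -> (a <= (b + e * c)%:E)%E) -> (a <= b%:E)%E.
Proof.
move=> h; apply/lee_addgt0Pr => e e0.
have c0 : 0 < `|c| + 1 by rewrite ltr_wpDl.
pose d := Num.min (2^-1) (e / (`|c| + 1)).
have d0 : 0 < d by rewrite lt_min invr_gt0 ltr0n divr_gt0.
have d1 : d < 1.
  by rewrite gt_min; apply/orP; left; rewrite invf_lt1// ltr1n.
apply: le_trans (h d _) _; first by rewrite d0.
rewrite -EFinD lee_fin lerD2l.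
have : d * (`|c| + 1) <= e.
  by rewrite -ler_pdivlMr// ge_min lexx orbT.
by apply: le_trans; rewrite ler_pM2l// (le_trans (ler_norm c))// lerDl.
Qed.

Lemma orth_proj_id n (U : {vspace 'cV[R]_n}) (Pi : 'M[R]_n) w :
  is_orth_proj U Pi -> w \in U -> Pi *m w = w.
Proof.
move=> hPi wU; have [PwU orth] := hPi w.
have dU : w - Pi *m w \in U by rewrite rpredB.
apply/eqP; rewrite eq_sym -subr_eq0; apply/eqP/quadform1_eq0.
by rewrite /quadform mulmx1 orth ?mxE.
Qed.

Lemma orth_proj_mul m n (U : {vspace 'cV[R]_m}) (Pi : 'M[R]_m)
    (K : 'M[R]_(m, n)) : is_orth_proj U Pi -> im_in K U -> Pi *m K = K.
Proof.
move=> hPi KU; apply/matrixP => i j.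
have /matrixP/(_ i 0) := orth_proj_id hPi (KU (delta_mx j 0)).
by rewrite mulmxA -!colE !mxE.
Qed.

Lemma im_in_proj m n (U : {vspace 'cV[R]_m}) (Pi : 'M[R]_m)
    (K : 'M[R]_(m, n)) : is_orth_proj U Pi -> im_in (Pi *m K) U.
Proof. by move=> hPi v; rewrite -mulmxA; have [] := hPi (K *m v). Qed.

Variables (q r p : nat) (A : 'M[R]_q) (B : 'M[R]_(q, r)).
Variables (C : 'M[R]_(p, q)) (D : 'M[R]_(p, r)).
Hypotheses (DC : D^T *m C = 0) (DD : D^T *m D \in unitmx).
Variables (U : {vspace 'cV[R]_r}) (Pi : 'M[R]_r).
Hypothesis hPi : is_orth_proj U Pi.
Variable K1 : 'M[R]_(r, q).
Hypotheses (K1U : im_in K1 U) (K1s : stabilizing A B K1).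
Variable x0 : 'cV[R]_q.

Let BS := B *m Pi.
Let DS := D *m Pi.

Let PiPi : Pi *m Pi = Pi.
Proof. by apply: (orth_proj_mul hPi) => v; have [] := hPi v. Qed.

Let DSC : DS^T *m C = 0.
Proof. by rewrite /DS trmx_mul -mulmxA DC mulmx0. Qed.

Let BSK (K : 'M[R]_(r, q)) : im_in K U -> BS *m K = B *m K.
Proof. by move=> KU; rewrite /BS -mulmxA (orth_proj_mul hPi KU). Qed.

Let DSK (K : 'M[R]_(r, q)) : im_in K U -> DS *m K = D *m K.
Proof. by move=> KU; rewrite /DS -mulmxA (orth_proj_mul hPi KU). Qed.

Let hK1 : hurwitz (A + BS *m K1).
Proof. by rewrite BSK//; exact: stabilizing_hurwitz. Qed.

Lemma lq_le_certified :
  (lq_value A BS C DS x0 <= certified_value A B C D U x0)%E.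
Proof.
apply: le_ereal_inf_tmp => _ [K [P [KU KP ->]]].
have KPS : lyapunov_cert A BS C DS K P by rewrite /lyapunov_cert BSK// DSK.
have Md : posdef ((C + DS *m K1)^T *m (C + DS *m K1) + 1%:M).
  by apply: posdefDl (psd_gram _) (posdef1 _ _).
have [P1 P1s P1E] := hurwitz_lyapunov_solve hK1 Md.1.
have P1d := hurwitz_lyapunov_posdef hK1 Md P1s P1E.
apply: (@lee_approx _ _ (quadform P1 x0 - quadform P x0)) => e e01.
have [Ke [Pe [hKe PeM Pex]]] := lyapunov_cert_mix KPS P1d P1E e01.
apply: (@le_trans _ _ (quadform Pe x0)%:E); last first.
  by rewrite lee_fin (le_trans (Pex x0))//; lra.
apply: le_trans (feedback_energy_le x0 hKe PeM).
apply: ereal_inf_lbound; eexists; eexists; split; last reflexivity.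
- exact: feedback_trajectory.
- exact: hKe.
Qed.

Lemma certified_le_sdp :
  (certified_value A B C D U x0 <= sdp_value A BS C DS x0)%E.
Proof.
apply: le_ereal_inf_tmp => _ [Zb [Zu [Zn [Zp ZE ->]]]].
have [c hc] := sdp_certificate_approx DSC hK1 Zp ZE.
apply: (@lee_approx _ _ c) => e /andP[e0 e1].
have [|K [P [KP Px]]] := hc e; first by rewrite e0 ltW.
apply: (@le_trans _ _ (quadform P x0)%:E); last by rewrite lee_fin.
apply: ereal_inf_lbound; exists (Pi *m K), P; split => //.
  exact: im_in_proj.
by move: KP; rewrite /lyapunov_cert /BS /DS -!mulmxA.
Qed.

Lemma sdp_le_lq : (sdp_value A BS C DS x0 <= lq_value A BS C DS x0)%E.
Proof.
apply: le_ereal_inf_tmp => _ [u [x [xu x_0 ->]]].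
have [->|Ey] := eqVneq (energy C DS u x) +oo%E; first exact: leey.
have Efin : (energy C DS u x < +oo)%E by rewrite ltey.
have E0 : (0 <= energy C DS u x)%E.
  by rewrite energyE; apply: integral_ge0 => t _; rewrite lee_fin quadform1_ge0.
rewrite -(@fineK _ (energy C DS u x)) ?ge0_fin_numE//.
(* This left inverse of D recovers Pi u from the output, as D^T C = 0. *)
pose L := invmx (D^T *m D) *m D^T.
have LC : L *m C = 0 by rewrite /L -mulmxA DC mulmx0.
have LD : L *m DS = Pi by rewrite /L /DS -mulmxA (mulmxA D^T) mulKmx.
have BSPi : BS *m Pi = BS by rewrite /BS -mulmxA PiPi.
have DSPi : DS *m Pi = DS by rewrite /DS -mulmxA PiPi.
set M := (C + DS *m K1)^T *m (C + DS *m K1).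
have [P Ps PE] := hurwitz_lyapunov_solve hK1 (psd_gram (C + DS *m K1)).1.
apply/lee_addgt0Pr => e e0.
have /cvgr0Pnorm_lt/(_ e e0) Pe := vanishes_quadform P x_0.
have [T [T0 PT]] : exists T, 0 <= T /\ quadform P (x T) < e.
  near (pinfty_nbhs R) => T; exists T; split.
    by near: T; exact: nbhs_pinfty_ge.
  by apply: le_lt_trans (ler_norm _) _; near: T.
have [Zb [Zu [Zn [Zp ZE Zc]]]] :=
  trajectory_covariance DSC BSPi DSPi LC LD xu Efin T0.
(* W is the covariance of the feedback K1 started at x T. *)
have [W Ws WE] := hurwitz_lyapunov_solve (hurwitz_tr hK1) (psd_outer (x T)).1.
have Wp := hurwitz_lyapunov_psd (hurwitz_tr hK1) (psd_outer (x T)) Ws WE.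
rewrite trmxK in WE.
have WB := psd_feedback_block K1 Wp.
apply: (@le_trans _ _ (mxinner (C^T *m C) (Zn + W) +
    mxinner (DS^T *m DS) (Zb + K1 *m W *m K1^T))%:E).
  apply: ereal_inf_lbound.
  exists (Zb + K1 *m W *m K1^T), (Zu + K1 *m W), (Zn + W); split => //.
    have := psdD Zp WB; rewrite add_block_mx.
    by have -> : (Zu + K1 *m W)^T = Zu^T + (K1 *m W)^T
      by apply/matrixP => i j; rewrite !mxE.
  have -> : - (x0 *m x0^T) = x T *m (x T)^T - x0 *m x0^T - x T *m (x T)^T.
    by rewrite addrAC subrr add0r.
  rewrite -ZE -WE.
  have -> : (Zu + K1 *m W)^T = Zu^T + W *m K1^T.
    by rewrite -{2}Ws -trmx_mul; apply/matrixP => i j; rewrite !mxE.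
  have -> : (A + BS *m K1)^T = A^T + K1^T *m BS^T.
    by rewrite -trmx_mul; apply/matrixP => i j; rewrite !mxE.
  rewrite !mulmxDl !mulmxDr !mulmxA.
  by apply/matrixP => i j; rewrite !mxE; ring.
rewrite -EFinD lee_fin.
have cW : mxinner (C^T *m C) W + mxinner (DS^T *m DS) (K1 *m W *m K1^T) =
    quadform P (x T).
  rewrite -tr_output_gram// -/M -[M]opprK -PE mulNmx raddfN /= tr_lyapunov WE.
  by rewrite mulmxN raddfN /= opprK tr_mul_outer.
move: Zc cW; rewrite /mxinner !mulmxDr !mxtraceD; lra.
Unshelve. all: by end_near. Qed.

Lemma certified_lq : certified_value A B C D U x0 = lq_value A BS C DS x0.
Proof.
by apply/eqP; rewrite eq_le lq_le_certified (le_trans certified_le_sdp sdp_le_lq).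
Qed.

Lemma certified_sdp : certified_value A B C D U x0 = sdp_value A BS C DS x0.
Proof.
by apply/eqP; rewrite eq_le certified_le_sdp (le_trans sdp_le_lq lq_le_certified).
Qed.

End Values.

(** * Block diagonal matrices *)

Section BlockDiagonal.
Variables (R : realType) (N : finType).

Lemma diagN_mul (m n l : N -> nat) (M : forall i, 'M[R]_(m i, n i))
    (M' : forall i, 'M[R]_(n i, l i)) :
  diagN M *m diagN M' = diagN (fun i => M i *m M' i).
Proof.
rewrite /diagN mul_mxblock; apply: eq_mxblock => i j.
rewrite (bigD1 i)//= big1 ?addr0 => [|k ki]; last first.
  by rewrite eq_sym (negbTE ki) mul0mx.
rewrite eqxx conform_mx_id; have [ij|] := eqVneq i j; last by rewrite mulmx0.
by case: j / ij; rewrite !conform_mx_id.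
Qed.

Lemma diagN_tr (m n : N -> nat) (M : forall i, 'M[R]_(m i, n i)) :
  (diagN M)^T = diagN (fun i => (M i)^T).
Proof.
rewrite /diagN tr_mxblock; apply: eq_mxblock => i j.
rewrite eq_sym; have [ij|] := eqVneq i j; last by rewrite trmx0.
by case: j / ij; rewrite !conform_mx_id.
Qed.

Lemma eq_diagN (m n : N -> nat) (M M' : forall i, 'M[R]_(m i, n i)) :
  (forall i, M i = M' i) -> diagN M = diagN M'.
Proof. by move=> MM'; apply: eq_mxblock => i j; rewrite MM'. Qed.

Lemma diagN0 (m n : N -> nat) : diagN (fun i => 0 : 'M[R]_(m i, n i)) = 0.
Proof.
rewrite /diagN -[RHS]mxblock0; apply: eq_mxblock => i j.
have [ij|//] := eqVneq i j.
by case: j / ij; rewrite conform_mx_id.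
Qed.

(** For square blocks, [diagN] is convertible to [\mxdiag]. *)
Lemma diagN1 (m : N -> nat) : diagN (fun i => 1%:M : 'M[R]_(m i)) = 1%:M.
Proof. exact: mxdiagZ. Qed.

Lemma diagN_unit (m : N -> nat) (M : forall i, 'M[R]_(m i)) :
  (forall i, M i \in unitmx) -> diagN M \in unitmx.
Proof.
move=> Mu; suff /mulmx1_unit[] :
    diagN M *m diagN (fun i => invmx (M i)) = 1%:M by [].
by rewrite diagN_mul -diagN1; apply: eq_diagN => i; exact: mulmxV.
Qed.

End BlockDiagonal.

Theorem theorem4 (R : realType) (N : finType) (q r p : N -> nat)
    (A : forall i j : N, 'M[R]_(q i, q j))
    (B : forall i j : N, 'M[R]_(q i, r j))
    (C : forall i : N, 'M[R]_(p i, q i))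
    (D : forall i : N, 'M[R]_(p i, r i))
    (hD : forall i : N, (D i)^T *m D i \in unitmx)
    (hDC : forall i : N, (D i)^T *m C i = 0)
    (x0 : 'cV[R]_(dimN q))
    (U : {set N} -> {vspace 'cV[R]_(dimN r)})
    (hUmono : forall S T : {set N}, S \subset T -> (U S <= U T)%VS)
    (hUfull : U [set: N]%SET = fullv)
    (hstab : forall S : {set N},
      exists (K : 'M[R]_(dimN r, dimN q)) (P : 'M[R]_(dimN q)),
        [/\ im_in K (U S),
            stabilizing (blockN A) (blockN B) K &
            lyapunov_cert (blockN A) (blockN B) (diagN C) (diagN D) K P])
    (Pi : {set N} -> 'M[R]_(dimN r))
    (hPi : forall S : {set N}, is_orth_proj (U S) (Pi S)) :
  let AN := blockN A in
  let BN := blockN B in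
  let CN := diagN C in
  let DN := diagN D in
  let nu := fun S : {set N} => certified_value AN BN CN DN (U S) x0 in
  let nuLQ := fun S : {set N} =>
    lq_value AN (BN *m Pi S) CN (DN *m Pi S) x0 in
  (forall S : {set N}, nu S = nuLQ S) /\
  (forall S : {set N},
     nu S = sdp_value AN (BN *m Pi S) CN (DN *m Pi S) x0).
Proof.
move=> AN BN CN DN nu nuLQ.
have DC : DN^T *m CN = 0.
  by rewrite diagN_tr diagN_mul -[RHS]diagN0; apply: eq_diagN.
have DD : DN^T *m DN \in unitmx.
  by rewrite diagN_tr diagN_mul; apply: diagN_unit.
by split=> S; have [K1 [P1 [K1U K1s _]]] := hstab S;
  [apply: (certified_lq DC DD (hPi S) K1U K1s)
  |apply: (certified_sdp DC DD (hPi S) K1U K1s)].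
Qed.
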